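(* Let $n$ be an even positive integer. Let $(Q_1,\sigma_1),\dots,(Q_n,\sigma_n)$ be quaternion algebras with involution of the first kind over a field $K$ of characteristic different from $2$ and let $$(A,\sigma)=(Q_1,\sigma_1)\otimes\cdots\otimes(Q_n,\sigma_n).$$ Then: (a) If $n\equiv 0\pmod 4$ and $\sigma$ is orthogonal then there exist quadratic spaces $(V,q)$ and $(V',q')$ of dimension $2n$ over $K$ such that $(A,\sigma)\simeq(C(V,q),J_q^{\mathrm{id}})$ and $(A,\sigma)\simeq(C(V',q'),J_{q'}^{-\mathrm{id}})$. (b) If $n\equiv 0\pmod 4$ and $\sigma$ is symplectic then there exist a quadratic space $(V,q)$ of dimension $2n$ over $K$ and a reflection $\tau$ of $(V,q)$ such that $(A,\sigma)\simeq(C(V,q),J_q^{\tau})$. (c) If $n\equiv 2\pmod 4$ and $\sigma$ is symplectic then there exist quadratic spaces $(V,q)$ and $(V',q')$ of dimension $2n$ over $K$ such that $(A,\sigma)\simeq(C(V,q),J_q^{\mathrm{id}})$ and $(A,\sigma)\simeq(C(V',q'),J_{q'}^{-\mathrm{id}})$. (d) If $n\equiv 2\pmod 4$ and $\sigma$ is orthogonal then there exist a quadratic space $(V,q)$ of dimension $2n$ over $K$ and a reflection $\tau$ of $(V,q)$ such that $(A,\sigma)\simeq(C(V,q),J_q^{\tau})$.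
   Context: A quadratic space $(V,q)$ over $K$ is a finite dimensional $K$-vector space $V$ with a quadratic form $q$; $b_q(x,y)=\frac12(q(x+y)-q(x)-q(y))$. $C(V,q)$ is the Clifford algebra $T(V)/(x\otimes x-q(x)\cdot 1: x\in V)$, with canonical injection $i_q:V\to C(V,q)$. An involution is an anti-automorphism whose square is the identity; an involution of a central simple $K$-algebra is of the first kind if it fixes $K$ elementwise, and is then either orthogonal or symplectic in the usual sense. An orthogonal symmetry of $(V,q)$ is a linear map $s:V\to V$ with $b_q(sx,sy)=b_q(x,y)$ for all $x,y$ and $s^2=\mathrm{id}$; it is a reflection if $\{x: s(x)=x\}$ is a hyperplane. $J_q^s$ is the unique $K$-linear involution of $C(V,q)$ with $J_q^s(i_q(x))=i_q(s(x))$ for all $x\in V$. Tensor products are over $K$. $\simeq$ denotes isomorphism of algebras with involution, i.e. a $K$-algebra isomorphism commuting with the involutions. *)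

(* Defs.v *)
From HB Require Import structures.
From mathcomp Require Import all_boot all_order all_algebra all_field.
From mathcomp Require Import boolp monalg ring.

Set Implicit Arguments.
Unset Strict Implicit.
Unset Printing Implicit Defensive.

Import GRing.Theory VectorInternalTheory.
Local Open Scope ring_scope.

Definition first_kind_involution (K : fieldType) (A : algType K) (s : A -> A) :
    Prop :=
  [/\ linear s, forall x y, s (x * y) = s y * s x & involutive s].

Definition isom_with_involution (K : fieldType) (A B : algType K)
    (s : A -> A) (t : B -> B) : Prop :=
  exists2 f : {lrmorphism A -> B}, bijective f & forall x, f (s x) = t (f x).

(* The quaternion algebra (a, b)_K; this presentation is the right notion only
   in characteristic different from 2. *)
Definition quaternion_algebra (K : fieldType) (Q : falgType K) : Prop :=
  exists (a b : K) (u v : Q),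
    [/\ a != 0 /\ b != 0, u * u = a%:A, v * v = b%:A, v * u = - (u * v)
      & basis_of {:Q} [:: 1; u; v; u * v]].

(* An isomorphism of L-algebras from L (x)_K A to 'M[L]_m, given by its
   restriction phi to A: the L-algebra maps from L (x)_K A correspond to the
   iota-semilinear multiplicative maps from A, and the last condition says that
   c (x) x |-> c *: phi x is bijective, L (x)_K A having as an L-basis the
   vectors 1 (x) e_i for e_i the chosen K-basis of A. *)
Definition splitting (K : fieldType) (A : falgType K) (L : fieldType)
    (iota : {rmorphism K -> L}) (m : nat) (phi : A -> 'M[L]_m) : Prop :=
  [/\ forall k x y, phi (k *: x + y) = iota k *: phi x + phi y,
      phi 1 = 1%:M,
      forall x y, phi (x * y) = phi x *m phi y
    & bijective (fun c : 'rV[L]_(\dim {:A}) =>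
        \sum_i c 0 i *: phi (vbasis {:A})`_i)].

Definition gram_form (L : fieldType) (m : nat) (g : 'M[L]_m) (u v : 'cV[L]_m) :
    L :=
  (u^T *m g *m v) 0 0.

(* Over some splitting field L of A, the L-linear extension of s becomes the
   adjoint involution of the form with Gram matrix g. *)
Definition adjoint_after_splitting (K : fieldType) (A : falgType K)
    (s : A -> A) (L : fieldType) (m : nat) (g : 'M[L]_m) : Prop :=
  exists (iota : {rmorphism K -> L}) (phi : A -> 'M[L]_m),
    splitting iota phi /\
    forall x u v,
      gram_form g (phi x *m u) v = gram_form g u (phi (s x) *m v).

Definition orthogonal_involution (K : fieldType) (A : falgType K)
    (s : A -> A) : Prop :=
  exists (L : fieldType) (m : nat) (g : 'M[L]_m),
    [/\ g \in unitmx, forall u v, gram_form g u v = gram_form g v u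
      & adjoint_after_splitting s g].

Definition symplectic_involution (K : fieldType) (A : falgType K)
    (s : A -> A) : Prop :=
  exists (L : fieldType) (m : nat) (g : 'M[L]_m),
    [/\ g \in unitmx, forall u, gram_form g u u = 0
      & adjoint_after_splitting s g].

(* The tensor product of the family Q of finite-dimensional algebras has as a basis the pure tensors of the chosen
   bases of the Q i; an element is stored as its family of coordinates. See
   pure_tensorM and tensor_map_pure. *)

Section TensorProduct.
Variables (K : fieldType) (I : finType).
Implicit Type Q : I -> falgType K.

Definition tensor_index Q := fprod (fun i => 'I_(\dim {:Q i})).

Definition tensor_prod Q : Type := {ffun tensor_index Q -> K^o}.

(* Only the vector space structure: the ring structure is not the pointwise
   one. *)
HB.instance Definition _ Q :=
  Vector.copy (tensor_prod Q) {ffun tensor_index Q -> K^o}.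

Definition tensor_coef Q (f : tensor_index Q) (a : tensor_prod Q) : K :=
  (a : {ffun _ -> _}) f.

Definition pure_tensor Q (x : forall i, Q i) : tensor_prod Q :=
  [ffun f : tensor_index Q => \prod_i coord (vbasis {:Q i}) (f i) (x i)].

Definition tensor_basis Q (f : tensor_index Q) (i : I) : Q i :=
  (vbasis {:Q i})`_(f i).

Definition tensor_mul Q (a b : tensor_prod Q) : tensor_prod Q :=
  \sum_f \sum_g (tensor_coef f a * tensor_coef g b) *:
    pure_tensor (fun i => tensor_basis f i * tensor_basis g i).

Definition tensor_one Q : tensor_prod Q := pure_tensor (fun i => 1).

Definition tensor_map Q (s : forall i, Q i -> Q i) (a : tensor_prod Q) :
    tensor_prod Q :=
  \sum_f tensor_coef f a *: pure_tensor (fun i => s i (tensor_basis f i)).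

Lemma prod_sum_fprod (T : I -> finType) (P : forall i, T i -> K) :
  \prod_i \sum_(j : T i) P i j = \sum_(f : fprod T) \prod_i P i (f i).
Proof.
pose P' i := [ffun j => P i j].
under eq_bigr => i _ do (under eq_bigr => j _ do rewrite -[P i j](ffunE (P i)));
  under eq_bigr => i _ do rewrite (big_tag P').
rewrite bigA_distr_big_dep.
under [RHS]eq_bigr => f _ do under eq_bigr => i _ do rewrite -[P i _](ffunE (P i)).
by rewrite (big_fprod 1 _ P').
Qed.

Lemma tensorP Q (a b : tensor_prod Q) :
  (forall f, tensor_coef f a = tensor_coef f b) -> a = b.
Proof. by move=> eq_ab; apply/ffunP. Qed.

Lemma coef_pure Q (x : forall i, Q i) f :
  tensor_coef f (pure_tensor x) = \prod_i coord (vbasis {:Q i}) (f i) (x i).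
Proof. exact: ffunE. Qed.

Lemma coef_is_linear Q f : scalar (@tensor_coef Q f).
Proof. by move=> k a b; rewrite /tensor_coef !ffunE. Qed.
HB.instance Definition _ Q f :=
  GRing.isLinear.Build K (tensor_prod Q) K *%R (@tensor_coef Q f)
    (@coef_is_linear Q f).

Lemma coefD Q (a b : tensor_prod Q) f :
  tensor_coef f (a + b) = tensor_coef f a + tensor_coef f b.
Proof. exact: (linearD (@tensor_coef Q f)). Qed.

Lemma coefZ Q k (a : tensor_prod Q) f :
  tensor_coef f (k *: a) = k * tensor_coef f a.
Proof. by rewrite /tensor_coef ffunE. Qed.

Lemma coef_sum Q (J : finType) (F : J -> tensor_prod Q) f :
  tensor_coef f (\sum_j F j) = \sum_j tensor_coef f (F j).
Proof. exact: (linear_sum (@tensor_coef Q f)). Qed.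

Lemma pure_ext Q (x y : forall i, Q i) :
  (forall i, x i = y i) -> pure_tensor x = pure_tensor y.
Proof.
by move=> eq_xy; apply: tensorP => f; rewrite !coef_pure; apply: eq_bigr => i _;
  rewrite eq_xy.
Qed.

Lemma pure_linear Q (L : forall i, {linear Q i -> Q i}) (x : forall i, Q i) :
  pure_tensor (fun i => L i (x i)) =
  \sum_f tensor_coef f (pure_tensor x) *:
    pure_tensor (fun i => L i (tensor_basis f i)).
Proof.
apply: tensorP => h; rewrite coef_sum coef_pure.
under [RHS]eq_bigr => f _ do rewrite coefZ !coef_pure -big_split.
rewrite -(prod_sum_fprod (fun i (j : 'I_(\dim {:Q i})) =>
  coord (vbasis {:Q i}) j (x i) *
  coord (vbasis {:Q i}) (h i) (L i (vbasis {:Q i})`_j))) /=.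
apply: eq_bigr => i _; rewrite {1}(coord_vbasis (memvf (x i))) !linear_sum.
by apply: eq_bigr => j _; rewrite !linearZ.
Qed.

Lemma coef_basis Q f h :
  tensor_coef h (pure_tensor (@tensor_basis Q f)) = (f == h)%:R.
Proof.
rewrite coef_pure /tensor_basis.
under eq_bigr => i _ do rewrite coord_free ?(basis_free (vbasisP _)) //.
have [<-|neq_fh] := eqVneq f h.
  by rewrite big1 // => i _; rewrite eqxx.
have [i neq_i] : exists i, f i != h i.
  apply/existsP; apply: contraR neq_fh => /existsPn eq_fh.
  by apply/eqP/fprodP => i; apply/eqP; rewrite -[_ == _]negbK eq_fh.
by rewrite (bigD1 i) //= -val_eqE /= eq_sym in neq_i *; rewrite (negPf neq_i) mul0r.
Qed.

Lemma tensor_expand Q (a : tensor_prod Q) :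
  a = \sum_f tensor_coef f a *: pure_tensor (@tensor_basis Q f).
Proof.
apply: tensorP => h; rewrite coef_sum (bigD1 h) //= coefZ coef_basis eqxx mulr1.
rewrite big1 ?addr0 // => f neq_fh.
by rewrite coefZ coef_basis (negPf neq_fh) mulr0.
Qed.

Lemma tensor_map_pure Q (s : forall i, Q i -> Q i) (x : forall i, Q i) :
  (forall i, linear (s i)) ->
  tensor_map s (pure_tensor x) = pure_tensor (fun i => s i (x i)).
Proof.
move=> s_lin.
pose mx i := GRing.isLinear.Build K (Q i) (Q i) *:%R (s i) (s_lin i).
pose L i : {linear Q i -> Q i} := HB.pack (s i) (mx i).
exact/esym/(pure_linear L).
Qed.

Lemma tensor_map_is_linear Q (s : forall i, Q i -> Q i) :
  linear (@tensor_map Q s).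
Proof.
move=> k a b; rewrite /tensor_map scaler_sumr -big_split /=.
by apply: eq_bigr => f _; rewrite coefD coefZ scalerDl scalerA.
Qed.

Lemma tensor_mulDl Q : left_distributive (@tensor_mul Q) +%R.
Proof.
move=> a b c; rewrite /tensor_mul -big_split /=; apply: eq_bigr => f _.
rewrite -big_split /=; apply: eq_bigr => g _.
by rewrite coefD mulrDl scalerDl.
Qed.

Lemma tensor_mulDr Q : right_distributive (@tensor_mul Q) +%R.
Proof.
move=> a b c; rewrite /tensor_mul -big_split /=; apply: eq_bigr => f _.
rewrite -big_split /=; apply: eq_bigr => g _.
by rewrite coefD mulrDr scalerDl.
Qed.

Lemma tensor_scaleAl Q k (a b : tensor_prod Q) :
  k *: tensor_mul a b = tensor_mul (k *: a) b.
Proof.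
rewrite /tensor_mul scaler_sumr; apply: eq_bigr => f _.
rewrite scaler_sumr; apply: eq_bigr => g _.
by rewrite coefZ scalerA mulrA.
Qed.

Lemma tensor_scaleAr Q k (a b : tensor_prod Q) :
  k *: tensor_mul a b = tensor_mul a (k *: b).
Proof.
rewrite /tensor_mul scaler_sumr; apply: eq_bigr => f _.
rewrite scaler_sumr; apply: eq_bigr => g _.
by rewrite coefZ scalerA mulrCA.
Qed.

Lemma tensor_mul_pure Q (x y : forall i, Q i) :
  tensor_mul (pure_tensor x) (pure_tensor y) = pure_tensor (fun i => x i * y i).
Proof.
rewrite [RHS](pure_linear (fun i => y i \o* idfun : {linear Q i -> Q i})).
apply: eq_bigr => f _.
transitivity (tensor_coef f (pure_tensor x) *: pure_tensor (fun i => tensor_basis f i * y i)); last by [].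
rewrite [X in _ *: X](pure_linear (fun i => tensor_basis f i \*o idfun : {linear Q i -> Q i})).
by rewrite scaler_sumr; apply: eq_bigr => g _; rewrite scalerA.
Qed.

Lemma tensor_ind Q (P : tensor_prod Q -> Prop) :
  (forall k a b, P a -> P b -> P (k *: a + b)) ->
  (forall x, P (pure_tensor x)) -> P 0 -> forall a, P a.
Proof.
move=> PD Ppure P0 a; rewrite (tensor_expand a).
elim/big_ind: _ => // [b c Pb Pc|f _]; first by rewrite -[b]scale1r; apply: PD.
by rewrite -[_ *: _]addr0; apply: PD.
Qed.

Lemma tensor_mul0 Q (a : tensor_prod Q) : tensor_mul 0 a = 0.
Proof. by have := tensor_scaleAl 0 0 a; rewrite !scale0r. Qed.

Lemma tensor_mulr0 Q (a : tensor_prod Q) : tensor_mul a 0 = 0.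
Proof. by have := tensor_scaleAr 0 a 0; rewrite !scale0r. Qed.

Lemma tensor_mulA Q : associative (@tensor_mul Q).
Proof.
move=> a b c.
elim/tensor_ind: a => [k a a' IH IH'|x|]; last by rewrite !tensor_mul0.
  by rewrite !tensor_mulDl -!tensor_scaleAl IH IH'.
elim/tensor_ind: b => [k b b' IH IH'|y|]; last by rewrite !tensor_mulr0 !tensor_mul0 tensor_mulr0.
  rewrite tensor_mulDl -tensor_scaleAl !tensor_mulDr -!tensor_scaleAr.
  by rewrite tensor_mulDl -tensor_scaleAl IH IH'.
elim/tensor_ind: c => [k c c' IH IH'|z|]; last by rewrite !tensor_mulr0.
  by rewrite !tensor_mulDr -!tensor_scaleAr IH IH'.
by rewrite !tensor_mul_pure; apply: pure_ext => i; rewrite mulrA.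
Qed.

Lemma tensor_mul1 Q : left_id (tensor_one Q) (@tensor_mul Q).
Proof.
elim/tensor_ind => [k a b IHa IHb|x|].
- by rewrite tensor_mulDr -tensor_scaleAr IHa IHb.
- by rewrite tensor_mul_pure; apply: pure_ext => i; rewrite mul1r.
- by rewrite tensor_mulr0.
Qed.

Lemma tensor_mulr1 Q : right_id (tensor_one Q) (@tensor_mul Q).
Proof.
elim/tensor_ind => [k a b IHa IHb|x|].
- by rewrite tensor_mulDl -tensor_scaleAl IHa IHb.
- by rewrite tensor_mul_pure; apply: pure_ext => i; rewrite mulr1.
- by rewrite tensor_mul0.
Qed.

Lemma tensor_one_neq0 Q : tensor_one Q != 0.
Proof.
have ex i : exists j, coord (vbasis {:Q i}) j 1 != 0.
  apply/existsP; apply: contraT => /existsPn c0.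
  case/eqP: (oner_neq0 (Q i)).
  rewrite (coord_vbasis (memvf 1)) big1 // => j _.
  by have /negPn/eqP-> := c0 j; rewrite scale0r.
pose f : tensor_index Q := fprod_of_fun (fun i => xchoose (ex i)).
apply/eqP => /(congr1 (fun a => tensor_coef f a)); rewrite coef_pure.
rewrite (linear0 (@tensor_coef Q f)) => /eqP; rewrite prodf_seq_eq0.
by case/hasP=> i _; rewrite fprodE; apply/negP/(xchooseP (ex i)).
Qed.

HB.instance Definition _ Q := GRing.Zmodule_isNzRing.Build (tensor_prod Q)
  (@tensor_mulA Q) (@tensor_mul1 Q) (@tensor_mulr1 Q)
  (@tensor_mulDl Q) (@tensor_mulDr Q) (@tensor_one_neq0 Q).
HB.instance Definition _ Q :=
  GRing.Lmodule_isLalgebra.Build K (tensor_prod Q) (@tensor_scaleAl Q).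
HB.instance Definition _ Q :=
  GRing.Lalgebra_isAlgebra.Build K (tensor_prod Q) (@tensor_scaleAr Q).
HB.instance Definition _ Q := Algebra_isFalgebra.Build K (tensor_prod Q).

Lemma pure_tensorM Q (x y : forall i, Q i) :
  pure_tensor x * pure_tensor y = pure_tensor (fun i => x i * y i).
Proof. exact: tensor_mul_pure. Qed.

Lemma pure_tensor1 Q : pure_tensor (fun=> 1) = 1 :> tensor_prod Q.
Proof. by []. Qed.

End TensorProduct.

Definition polar (K : fieldType) (V : vectType K) (q : V -> K) (x y : V) : K :=
  q (x + y) - q x - q y.

Definition quadratic_form (K : fieldType) (V : vectType K) (q : V -> K) :
    Prop :=
  (forall a x, q (a *: x) = a ^+ 2 * q x) /\ (forall y, scalar ((polar q)^~ y)).

Record quadSpace (K : fieldType) := QuadSpace {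
  qspace :> vectType K;
  qform : qspace -> K;
  qformP : quadratic_form qform
}.

Definition bform (K : fieldType) (V : quadSpace K) (x y : V) : K :=
  2^-1 * polar (@qform K V) x y.

Lemma malg_scaleAr (K : fieldType) (M : monomType) k (s t : {malg K[M]}) :
  k *: (s * t) = s * (k *: t).
Proof.
have kC : k%:MP * s = s * k%:MP.
  rewrite !malgM_def fgmulUg fgmulgU; apply: eq_bigr => w _.
  by rewrite mul1m mulm1 mulrC.
by rewrite -!mul_malgC mulrA kC mulrA.
Qed.

Lemma malgUZ (K : fieldType) (M : monomType) (c : K) (w : M) :
  << c *g w >> = c *: << w >>.
Proof. by apply/malgP => u; rewrite mcoeffZ !mcoeffU mulrnAr mulr1. Qed.

Section TensorAlgebra.
Variables (K : fieldType) (V : vectType K).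

(* T(V), as the algebra of noncommutative polynomials in the chosen basis of
   V. *)
Definition tensor_algebra : Type := {malg K[{fmonom 'I_(\dim {:V})}]}.

HB.instance Definition _ :=
  GRing.Lalgebra.copy tensor_algebra {malg K[{fmonom 'I_(\dim {:V})}]}.

Lemma tensor_algebra_scaleAr k (s t : tensor_algebra) :
  k *: (s * t) = s * (k *: t).
Proof. exact: malg_scaleAr. Qed.

HB.instance Definition _ :=
  GRing.Lalgebra_isAlgebra.Build K tensor_algebra tensor_algebra_scaleAr.

(* Here and below, definitions are locked where unification would otherwise
   unfold them down to coordinates or representatives. *)
Fact clifford_key : unit. Proof. exact: tt. Qed.
Definition tensor_inj : V -> tensor_algebra :=
  locked_with clifford_key
    (fun x => \sum_(i < \dim {:V}) coord (vbasis {:V}) i x *: << fmu i >>).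

Lemma tensor_injE x :
  tensor_inj x = \sum_(i < \dim {:V}) coord (vbasis {:V}) i x *: << fmu i >>.
Proof. by rewrite /tensor_inj locked_withE. Qed.

Lemma tensor_inj_is_linear : linear tensor_inj.
Proof.
move=> k x y; rewrite !tensor_injE scaler_sumr -big_split /=.
by apply: eq_bigr => i _; rewrite linearP scalerDl scalerA.
Qed.

Lemma tensor_inj_basis (i : 'I_(\dim {:V})) : tensor_inj (vbasis {:V})`_i = << fmu i >>.
Proof.
rewrite tensor_injE (bigD1 i) //= big1 ?addr0 => [|j neq_ji].
  by rewrite coord_free ?(basis_free (vbasisP _)) // eqxx scale1r.
rewrite coord_free ?(basis_free (vbasisP _)) //.
by rewrite (_ : (_ == _) = false) ?scale0r //; apply/negbTE; rewrite eq_sym.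
Qed.

Lemma tensor_algebra_ind (P : tensor_algebra -> Prop) :
  P 1 -> (forall k s t, P s -> P t -> P (k *: s + t)) ->
  (forall x t, P t -> P (tensor_inj x * t)) -> forall t, P t.
Proof.
move=> P1 PD PM t.
have P0 : P 0 by have := PD (-1) _ _ P1 P1; rewrite scaleN1r addNr.
have Pw w : P << w >>.
  rewrite -[w]fmK; elim: (w : seq _) => {w} [|i w IH]; first by rewrite -fmoneE.
  have := PM (vbasis {:V})`_i _ IH; rewrite tensor_inj_basis.
  congr P; rewrite [LHS]fgmulUU mulr1; congr << _ >>.
  by apply/eqP; rewrite fmP fmM fmU.
rewrite -[t]/(t : {malg _[_]}) (monalgE t).
elim/big_ind: _ => // [r s Pr Ps|w _]; first by rewrite -[r]scale1r; apply: PD.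
by rewrite [X in P X]malgUZ -[_ *: _]addr0; apply: PD.
Qed.

Section Lift.
Variables (B : algType K) (f : V -> B).

Let h (w : {fmonom 'I_(\dim {:V})}) : B := \prod_(i <- w : seq _) f (vbasis {:V})`_i.

Let hM : mmorphism h.
Proof.
split => [u v|]; last by rewrite /h fm1 big_nil.
by rewrite /h fmM big_cat.
Qed.
HB.instance Definition _ := isMultiplicative.Build _ _ h hM.

Definition tensor_lift : tensor_algebra -> B := mmap (in_alg B) h.

Lemma tensor_lift_is_zmod : additive tensor_lift.
Proof. exact: mmap_is_additive. Qed.
HB.instance Definition _ := GRing.isZmodMorphism.Build tensor_algebra B tensor_lift
  tensor_lift_is_zmod.

Lemma tensor_lift_is_monoid : monoid_morphism tensor_lift.
Proof.
have [lM l1] : MMorphism.axiom tensor_lift.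
  apply: commr_mmap_is_multiplicative => g m m'.
  by rewrite /GRing.comm /= mulr_algl mulr_algr.
by split.
Qed.
HB.instance Definition _ :=
  GRing.isMonoidMorphism.Build tensor_algebra B tensor_lift tensor_lift_is_monoid.
Lemma tensor_lift_is_scalable : scalable tensor_lift.
Proof. by move=> k t; rewrite [LHS](@mmapZ _ _ _ (in_alg B) h) mulr_algl. Qed.
HB.instance Definition _ := GRing.isScalable.Build K tensor_algebra B *:%R tensor_lift
  tensor_lift_is_scalable.

Lemma tensor_lift_inj : linear f -> forall x, tensor_lift (tensor_inj x) = f x.
Proof.
move=> f_lin.
pose mx := GRing.isLinear.Build K V B *:%R f f_lin.
pose L : {linear V -> B} := HB.pack f mx.
move=> x; rewrite tensor_injE linear_sum -[f]/(L : V -> B) {2}(coord_vbasis (memvf x)) linear_sum.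
apply: eq_bigr => i _; rewrite !linearZ /=; congr (_ *: _).
by rewrite /tensor_lift mmapU /= scale1r mul1r /h fmU big_seq1.
Qed.
End Lift.
End TensorAlgebra.

Section Clifford.
Variables (K : fieldType) (V : quadSpace K).
Notation T := (tensor_algebra V).

(* The two-sided ideal generated by the x (x) x - q(x). *)
Inductive clifford_ideal : T -> Prop :=
| clifford_ideal_gen x :
    clifford_ideal (tensor_inj x * tensor_inj x - (qform x)%:A)
| clifford_ideal0 : clifford_ideal 0
| clifford_idealD s t :
    clifford_ideal s -> clifford_ideal t -> clifford_ideal (s + t)
| clifford_idealMl s t : clifford_ideal t -> clifford_ideal (s * t)
| clifford_idealMr s t : clifford_ideal s -> clifford_ideal (s * t).

Lemma clifford_idealN s : clifford_ideal s -> clifford_ideal (- s).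
Proof. by move=> Is; rewrite -mulN1r; apply: clifford_idealMl. Qed.

Lemma clifford_idealZ k s : clifford_ideal s -> clifford_ideal (k *: s).
Proof. by move=> Is; rewrite -mulr_algl; apply: clifford_idealMl. Qed.

Definition clifford_eqv (s t : T) : bool := `[< clifford_ideal (s - t) >].

Lemma clifford_eqv_is_equiv : equiv_class_of clifford_eqv.
Proof.
split=> [s|s t|t s u].
- by apply/asboolP; rewrite subrr; constructor.
- by apply/asboolP/asboolP => /clifford_idealN; rewrite opprB.
- move=> /asboolP st /asboolP tu; apply/asboolP.
  by rewrite -(subrKA t); apply: clifford_idealD.
Qed.
Canonical clifford_equiv := EquivRelPack clifford_eqv_is_equiv.

Definition clifford : Type := {eq_quot clifford_equiv}%qT.
HB.instance Definition _ := Choice.on clifford.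

Definition clifford_pi : T -> clifford :=
  locked_with clifford_key (fun t => (\pi_{eq_quot clifford_equiv} t)%qT).
Definition clifford_repr : clifford -> T :=
  locked_with clifford_key
    (fun a => repr (a : {eq_quot clifford_equiv}%qT)).

Lemma clifford_reprK a : clifford_pi (clifford_repr a) = a.
Proof. by rewrite /clifford_pi /clifford_repr !locked_withE; exact: reprK. Qed.

Lemma clifford_piE s t : clifford_pi s = clifford_pi t <-> clifford_ideal (s - t).
Proof.
rewrite /clifford_pi locked_withE.
split=> [eq_st|Ist]; last by apply/eqquotP/asboolP.
by apply/asboolP; have /eqquotP := eq_st.
Qed.

Definition clifford_add : clifford -> clifford -> clifford :=
  locked_with clifford_key
    (fun a b => clifford_pi (clifford_repr a + clifford_repr b)).
Definition clifford_opp : clifford -> clifford :=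
  locked_with clifford_key (fun a => clifford_pi (- clifford_repr a)).
Definition clifford_mul : clifford -> clifford -> clifford :=
  locked_with clifford_key
    (fun a b => clifford_pi (clifford_repr a * clifford_repr b)).
Definition clifford_scale : K -> clifford -> clifford :=
  locked_with clifford_key (fun k a => clifford_pi (k *: clifford_repr a)).

Lemma clifford_repr_pi s : clifford_ideal (clifford_repr (clifford_pi s) - s).
Proof. by apply/clifford_piE; rewrite clifford_reprK. Qed.

Lemma clifford_piD s t :
  clifford_pi (s + t) = clifford_add (clifford_pi s) (clifford_pi t).
Proof.
rewrite /clifford_add locked_withE.
apply/esym/clifford_piE; rewrite opprD addrACA.
by apply: clifford_idealD; apply: clifford_repr_pi.
Qed.

Lemma clifford_piN s : clifford_pi (- s) = clifford_opp (clifford_pi s).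
Proof.
rewrite /clifford_opp locked_withE.
apply/esym/clifford_piE; rewrite -opprD.
by apply: clifford_idealN; apply: clifford_repr_pi.
Qed.

Lemma clifford_piM s t :
  clifford_pi (s * t) = clifford_mul (clifford_pi s) (clifford_pi t).
Proof.
rewrite /clifford_mul locked_withE.
apply/esym/clifford_piE; set s' := clifford_repr _; set t' := clifford_repr _.
rewrite (_ : _ - _ = (s' - s) * t' + s * (t' - t)); last first.
  by rewrite mulrBl mulrBr subrKA.
by apply: clifford_idealD; [apply: clifford_idealMr|apply: clifford_idealMl];
  apply: clifford_repr_pi.
Qed.

Lemma clifford_piZ k s : clifford_pi (k *: s) = clifford_scale k (clifford_pi s).
Proof.
rewrite /clifford_scale locked_withE.
apply/esym/clifford_piE; rewrite -scalerBr.
by apply: clifford_idealZ; apply: clifford_repr_pi.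
Qed.

Let piE := (clifford_piD, clifford_piN, clifford_piM, clifford_piZ).

Ltac lift_clifford := repeat (let a := fresh "a" in
  move=> a; rewrite -(clifford_reprK a); move: (clifford_repr a) => {}a);
  rewrite -?piE.

Lemma clifford_addA : associative clifford_add.
Proof. by lift_clifford; rewrite addrA. Qed.
Lemma clifford_addC : commutative clifford_add.
Proof. by lift_clifford; rewrite addrC. Qed.
Lemma clifford_add0 : left_id (clifford_pi 0) clifford_add.
Proof. by lift_clifford; rewrite add0r. Qed.
Lemma clifford_addN : left_inverse (clifford_pi 0) clifford_opp clifford_add.
Proof. by lift_clifford; rewrite addNr. Qed.
HB.instance Definition _ := GRing.isZmodule.Build clifford
  clifford_addA clifford_addC clifford_add0 clifford_addN.

Lemma clifford_scaleA k l a :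
  clifford_scale k (clifford_scale l a) = clifford_scale (k * l) a.
Proof. by move: a; lift_clifford; rewrite scalerA. Qed.
Lemma clifford_scale1 : left_id 1 clifford_scale.
Proof. by lift_clifford; rewrite scale1r. Qed.
Lemma clifford_scaleDr : right_distributive clifford_scale +%R.
Proof.
move=> k; rewrite /+%R /=.
by lift_clifford; rewrite scalerDr.
Qed.
Lemma clifford_scaleDl a : {morph clifford_scale^~ a : k l / k + l}.
Proof.
move=> k l; rewrite [in RHS]/+%R /=.
by move: a; lift_clifford; rewrite scalerDl.
Qed.
HB.instance Definition _ := GRing.Zmodule_isLmodule.Build K clifford
  clifford_scaleA clifford_scale1 clifford_scaleDr clifford_scaleDl.

Lemma clifford_mulA : associative clifford_mul.
Proof. by lift_clifford; rewrite mulrA. Qed.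
Lemma clifford_mul1 : left_id (clifford_pi 1) clifford_mul.
Proof. by lift_clifford; rewrite mul1r. Qed.
Lemma clifford_mulr1 : right_id (clifford_pi 1) clifford_mul.
Proof. by lift_clifford; rewrite mulr1. Qed.
Lemma clifford_mulDl : left_distributive clifford_mul +%R.
Proof. by rewrite /+%R /=; lift_clifford; rewrite mulrDl. Qed.
Lemma clifford_mulDr : right_distributive clifford_mul +%R.
Proof. by rewrite /+%R /=; lift_clifford; rewrite mulrDr. Qed.

Lemma clifford_lift_ideal (B : algType K) (f : V -> B) : linear f ->
  (forall x, f x * f x = (qform x)%:A) ->
  forall t, clifford_ideal t -> tensor_lift f t = 0.
Proof.
move=> f_lin fq t; elim=> {t} [x||s t _ IHs _ IHt|s t _ IH|s t _ IH].
- rewrite rmorphB rmorphM /= tensor_lift_inj // fq linearZ rmorph1.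
  by rewrite subrr.
- by rewrite rmorph0.
- by rewrite rmorphD /= IHs IHt addr0.
- by rewrite rmorphM /= IH mulr0.
- by rewrite rmorphM /= IH mul0r.
Qed.

End Clifford.

(* By induction on the dimension: C(V, q) has a nonzero representation, hence is
   not the zero ring, even when q is degenerate. *)
Lemma quadratic_form_rep (K : fieldType) d (q : 'rV[K]_d -> K) :
  quadratic_form q ->
  exists m (f : 'rV[K]_d -> 'M[K]_m.+1),
    linear f /\ forall x, f x * f x = (q x)%:A.
Proof.
elim: d => [|d IH] in q *.
  case=> qZ _; exists 0, (fun=> 0); split=> [k x y|x].
    by rewrite scaler0 addr0.
  by have := qZ 0 0; rewrite mulr0 (thinmx0 x) scale0r expr0n mul0r => ->;
    rewrite scale0r.
rewrite -[d.+1]/(1 + d)%N in q * => -[qZ qL].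
have q0 : q 0 = 0 by have := qZ 0 0; rewrite scale0r expr0n mul0r.
pose inr (x : 'rV[K]_d) : 'rV[K]_(1 + d) := row_mx 0 x.
pose e : 'rV[K]_(1 + d) := row_mx 1%:M 0.
pose l x := polar q e (inr x).
have inrZ k x : inr (k *: x) = k *: inr x.
  by rewrite /inr scale_row_mx scaler0.
have inrD x y : inr (x + y) = inr x + inr y.
  by rewrite /inr add_row_mx addr0.
have polC x y : polar q x y = polar q y x.
  by rewrite /polar [y + x]addrC addrAC.
have lP : scalar l.
  by move=> k x y; rewrite /l !(polC e) inrD inrZ (qL e).
have [|m [f [f_lin fq]]] := IH (q \o inr).
  split=> [k x|y k x x'] /=; first by rewrite inrZ qZ.
  by have := qL (inr y) k (inr x) (inr x'); rewrite /polar /= !inrD inrZ.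
pose c (x : 'rV[K]_(1 + d)) := lsubmx x 0 0.
pose F (x : 'rV[K]_(1 + d)) : 'M[K]_(m.+1 + m.+1) :=
  block_mx (f (rsubmx x)) (c x * q e + l (rsubmx x))%:M (c x)%:M (- f (rsubmx x)).
have qE x : q x = q (inr (rsubmx x)) + c x * (c x * q e + l (rsubmx x)).
  have xE : x = c x *: e + inr (rsubmx x).
    rewrite -[LHS]hsubmxK /e /inr scale_row_mx add_row_mx scaler0 addr0 add0r.
    congr row_mx; apply/rowP => i; rewrite !mxE ord1 /c mxE.
    by rewrite eqxx mulr1.
  have : polar q (c x *: e) (inr (rsubmx x)) = c x * l (rsubmx x).
    have := qL (inr (rsubmx x)) (c x) e 0; rewrite addr0 => ->.
    by rewrite /polar add0r q0 subr0 subrr addr0.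
  rewrite /polar -xE qZ => /eqP; rewrite !subr_eq => /eqP ->.
  by ring.
have F_lin : linear F.
  move=> k x y.
  have rD : rsubmx (k *: x + y) = k *: rsubmx x + rsubmx y by rewrite linearP.
  have cD : c (k *: x + y) = k * c x + c y by rewrite /c !mxE.
  rewrite /F rD cD f_lin lP scale_block_mx add_block_mx; congr block_mx.
  - by rewrite scale_scalar_mx -raddfD /=; congr _%:M; ring.
  - by rewrite scale_scalar_mx -raddfD.
  - by rewrite scalerN opprD.
have Fq x : F x *m F x = (q x)%:M.
  have fqx : f (rsubmx x) *m f (rsubmx x) = (q (inr (rsubmx x)))%:M.
    by have := fq (rsubmx x); rewrite -scalemx1.
  rewrite /F mulmx_block !mulmxN !mulNmx opprK fqx.
  set g := f _; set s := _ + l _.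
  rewrite -!(scalar_mxC _ g) !subrr -!scalar_mxM -!raddfD /=.
  rewrite [s * _]mulrC [c x * s + _]addrC -qE.
  by rewrite -scalar_mx_block.
exists (m + m.+1)%N, F; split=> [//|x].
rewrite [LHS]Fq; exact/esym/scalemx1.
Qed.

Section CliffordAlgebra.
Variables (K : fieldType) (V : quadSpace K).
Notation T := (tensor_algebra V).

Lemma clifford_one_neq0 : clifford_pi (1 : T) != 0.
Proof.
have [qZ qL] := qformP V.
have [|m [F [F_lin Fq]]] := @quadratic_form_rep K _ (@qform K V \o r2v).
  split=> [a u|y k u v] /=; first by rewrite linearZ qZ.
  by have := qL (r2v y) k (r2v u) (r2v v); rewrite /polar /= !linearD linearZ.
pose f (x : V) := F (v2r x).
have f_lin : linear f by move=> k x y; rewrite /f linearP F_lin.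
have fq x : f x * f x = (qform x)%:A by rewrite /f Fq /= v2rK.
apply/eqP => /clifford_piE; rewrite subr0 => /(clifford_lift_ideal f_lin fq).
by rewrite rmorph1; apply/eqP/oner_neq0.
Qed.

HB.instance Definition _ := GRing.Zmodule_isNzRing.Build (clifford V)
  (@clifford_mulA K V) (@clifford_mul1 K V) (@clifford_mulr1 K V)
  (@clifford_mulDl K V) (@clifford_mulDr K V) clifford_one_neq0.

Lemma clifford_scaleAl k (a b : clifford V) : k *: (a * b) = (k *: a) * b.
Proof.
rewrite -(clifford_reprK a) -(clifford_reprK b).
rewrite -[_ * _]clifford_piM -[LHS]clifford_piZ.
by rewrite -[k *: _]clifford_piZ -[RHS]clifford_piM scalerAl.
Qed.
HB.instance Definition _ :=
  GRing.Lmodule_isLalgebra.Build K (clifford V) clifford_scaleAl.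

Lemma clifford_scaleAr k (a b : clifford V) : k *: (a * b) = a * (k *: b).
Proof.
rewrite -(clifford_reprK a) -(clifford_reprK b).
rewrite -[_ * _]clifford_piM -[LHS]clifford_piZ.
by rewrite -[k *: _]clifford_piZ -[RHS]clifford_piM scalerAr.
Qed.
HB.instance Definition _ :=
  GRing.Lalgebra_isAlgebra.Build K (clifford V) clifford_scaleAr.

Lemma clifford_pi_is_linear : linear (@clifford_pi K V).
Proof. by move=> k s t; rewrite clifford_piD clifford_piZ. Qed.
HB.instance Definition _ := GRing.isLinear.Build K T (clifford V) *:%R
  (@clifford_pi K V) clifford_pi_is_linear.

Lemma clifford_pi_is_monoid : monoid_morphism (@clifford_pi K V).
Proof. by split=> // s t; rewrite clifford_piM. Qed.
HB.instance Definition _ := GRing.isMonoidMorphism.Build T (clifford V)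
  (@clifford_pi K V) clifford_pi_is_monoid.

Definition clifford_inj (x : V) : clifford V := clifford_pi (tensor_inj x).

Lemma clifford_inj_is_linear : linear clifford_inj.
Proof. by move=> k x y; rewrite /clifford_inj tensor_inj_is_linear linearP. Qed.
HB.instance Definition _ := GRing.isLinear.Build K V (clifford V) *:%R
  clifford_inj clifford_inj_is_linear.

Lemma clifford_inj_sqr x : clifford_inj x * clifford_inj x = (qform x)%:A.
Proof.
apply/eqP; rewrite -subr_eq0 -rmorphM -(rmorph1 (@clifford_pi K V)) -linearZ -rmorphB.
by apply/eqP/clifford_piE; rewrite subr0; constructor.
Qed.

Lemma clifford_lift (B : algType K) (f : {linear V -> B}) :
  (forall x, f x * f x = (qform x)%:A) ->
  exists g : {lrmorphism clifford V -> B}, forall x, g (clifford_inj x) = f x.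
Proof.
move=> fq; pose g (a : clifford V) := tensor_lift f (clifford_repr a).
have f_lin : linear f by exact: linearP.
have gpi t : g (clifford_pi t) = tensor_lift f t.
  apply/eqP; rewrite -subr_eq0 -rmorphB /=; apply/eqP.
  exact: (clifford_lift_ideal f_lin fq (clifford_repr_pi t)).
have g_lin : linear g.
  move=> k a b; rewrite -(clifford_reprK a) -(clifford_reprK b).
  by rewrite -linearP !gpi linearP.
have g_mon : monoid_morphism g.
  split=> [|a b]; first by rewrite -(rmorph1 (@clifford_pi K V)) gpi rmorph1.
  rewrite -(clifford_reprK a) -(clifford_reprK b).
  by rewrite -rmorphM !gpi rmorphM.
pose gL := GRing.isLinear.Build K (clifford V) B *:%R g g_lin.
pose gM := GRing.isMonoidMorphism.Build (clifford V) B g g_mon.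
pose G : {lrmorphism clifford V -> B} := HB.pack g gL gM.
by exists G => x; rewrite -[LHS]/(g _) gpi tensor_lift_inj.
Qed.

Lemma clifford_ind (P : clifford V -> Prop) :
  P 1 -> (forall k a b, P a -> P b -> P (k *: a + b)) ->
  (forall x a, P a -> P (clifford_inj x * a)) -> forall a, P a.
Proof.
move=> P1 PD PM a; rewrite -(clifford_reprK a); move: (clifford_repr a) => t.
elim/tensor_algebra_ind: t => [|k s t Ps Pt|x t Pt].
- by rewrite rmorph1.
- by rewrite linearP; apply: PD.
- by rewrite rmorphM; apply: PM.
Qed.

End CliffordAlgebra.

Definition orthogonal_symmetry (K : fieldType) (V : quadSpace K)
    (s : 'End(V)) : Prop :=
  (forall x y : V, bform (s x) (s y) = bform x y) /\ (s \o s = \1)%VF.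

Definition reflection (K : fieldType) (V : quadSpace K) (s : 'End(V)) : Prop :=
  orthogonal_symmetry s /\ (\dim (fixedSpace s)).+1 = \dim {:V}.

(* J is J_q^s; see clifford_involution_uniq. *)
Definition clifford_involution (K : fieldType) (V : quadSpace K) (s : 'End(V))
    (J : clifford V -> clifford V) : Prop :=
  first_kind_involution J /\
  forall x : V, J (clifford_inj x) = clifford_inj (s x).

Lemma clifford_involution_uniq (K : fieldType) (V : quadSpace K) (s : 'End(V))
    (J J' : clifford V -> clifford V) :
  clifford_involution s J -> clifford_involution s J' -> J =1 J'.
Proof.
have inv1 (I : clifford V -> clifford V) : first_kind_involution I -> I 1 = 1.
  by case=> _ IM II; rewrite -[LHS]mulr1 -{2}[1]II -IM mulr1 II.
move=> [Jinv JV] [J'inv J'V]; have [[JL JM _] [J'L J'M _]] := (Jinv, J'inv).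
elim/clifford_ind => [|k a b IHa IHb|x a IH]; first by rewrite !inv1.
  by rewrite JL J'L IHa IHb.
by rewrite JM J'M JV J'V IH.
Qed.

Definition isom_clifford (K : fieldType) (A : algType K) (s : A -> A)
    (V : quadSpace K) (t : 'End(V)) : Prop :=
  exists2 J : clifford V -> clifford V,
    clifford_involution t J & isom_with_involution s J.

(* Main.v *)
(* Let t count the minus signs in a list of 2n pairwise anticommuting elements of
   A with squares in K^* and signs +-1 under sigma.  The 4^n products of
   sublists form a basis of A, so A is the Clifford algebra of the diagonal
   form given by the squares, and sigma is J^tau for the tau given by the signs.
   One such list comes from the quaternion factors, in the Jordan-Wigner manner.
   With w the product of four elements of sign -1, replacing each x of the four by
   x w makes all four signs +1; replacing a suitable element by the product of the
   whole list, whose sign is (-1)^t as n is even, turns t = 2 into 1 and t = 3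
   into 4.  So t can be
   brought to 0 or 1, and multiplying every element by the product of all exchanges
   the signs all +1 and all -1.  The trace of sigma, which is 2^n if sigma is
   orthogonal and -2^n if it is symplectic, equals (-4)^(n/2) if t = 0 and
   -(-4)^(n/2) if t = 1, and so decides between the two. *)

From HB Require Import structures.
Require Import Defs.
From mathcomp Require Import all_boot all_order all_algebra all_field.
From mathcomp Require Import ring zify.

Set Implicit Arguments.
Unset Strict Implicit.
Unset Printing Implicit Defensive.

Import GRing.Theory.
Local Open Scope ring_scope.

(** * Anticommuting systems *)

Section AnticommutingSystems.
Variables (K : fieldType) (A : algType K).
Implicit Types (x y z : A) (s r : seq A) (bs : seq bool).

Definition anticomm x y : bool := x * y == - (y * x).

Lemma anticomm_sym x y : anticomm x y = anticomm y x.
Proof. by rewrite /anticomm eq_sym eqr_oppLR. Qed.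

Definition unit_square x : Prop := exists2 c : K, c != 0 & x * x = c%:A.

Definition anticomm_system s : Prop :=
  pairwise anticomm s /\ {in s, forall x, unit_square x}.

Definition mask_prod s bs : A := \prod_(x <- mask bs s) x.

(** A factor equal to [x] commutes with [x], so only the other factors contribute a sign. *)
Lemma mul_prod_sign x r : {in r, forall y, y != x -> anticomm x y} ->
  x * \prod_(y <- r) y =
  (-1) ^+ count (predC1 x) r *: (\prod_(y <- r) y * x).
Proof.
elim: r => [|y r IH] xr; first by rewrite big_nil mulr1 mul1r scale1r.
rewrite big_cons -mulrA /= exprD -scalerA.
have {}IH := IH (fun z rz => xr z (@mem_behead _ (_ :: r) z rz)).
case: (eqVneq y x) => [->|neq_yx] /=; first by rewrite expr0 scale1r {1}IH -scalerAr.
have /eqP xy := xr y (mem_head _ _) neq_yx.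
by rewrite mulrA xy mulNr -mulrA IH expr1 scaleN1r -scalerAr.
Qed.

Lemma mul_prod_anticomm x r : {in r, forall y, anticomm x y} ->
  x * \prod_(y <- r) y = (-1) ^+ size r *: (\prod_(y <- r) y * x).
Proof.
elim: r => [|y r IH] xr; first by rewrite big_nil mulr1 mul1r scale1r.
have /eqP xy := xr y (mem_head _ _).
rewrite big_cons mulrA xy mulNr -(mulrA y x) IH => [|z rz]; last first.
  by apply: xr; rewrite inE rz orbT.
by rewrite /= exprS -scalerA scaleN1r -scalerAr mulrA.
Qed.

(** Reversal crosses each pair of factors once, at the cost of one sign per pair. *)
Lemma prod_rev r : pairwise anticomm r ->
  \prod_(x <- rev r) x = (-1) ^+ 'C(size r, 2) *: \prod_(x <- r) x.
Proof.
elim: r => [|x r IH]; first by rewrite big_nil scale1r.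
rewrite pairwise_cons => /andP[/allP xr anti_r].
rewrite rev_cons -cats1 big_cat big_seq1 IH //= big_cons binS bin1 exprD.
rewrite -scalerAl -scalerA.
by rewrite mul_prod_anticomm ?signrZK //; apply/allP.
Qed.

(** The product times its reversal telescopes to the product of the squares, and the reversal equals
    the product up to sign. *)
Lemma unit_square_prod r : pairwise anticomm r ->
  {in r, forall x, unit_square x} -> unit_square (\prod_(x <- r) x).
Proof.
move=> anti_r sq_r.
have [c c0 cE] : exists2 c : K, c != 0 &
    \prod_(x <- r) x * \prod_(x <- rev r) x = c%:A.
  elim: r sq_r {anti_r} => [|x r IH] sq_r.
    by exists 1; rewrite ?oner_neq0 // big_nil mulr1 scale1r.
  have [c c0 cE] := IH (fun z rz => sq_r z (@mem_behead _ (_ :: r) z rz)).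
  have [d d0 dE] := sq_r x (mem_head _ _).
  exists (c * d); first by rewrite mulf_neq0.
  rewrite rev_cons -cats1 big_cat big_seq1 /= big_cons.
  rewrite -!mulrA [X in x * X]mulrA cE -scalerAl mul1r -scalerAr dE.
  by rewrite scalerA.
exists ((-1) ^+ 'C(size r, 2) * c); first by rewrite mulf_neq0 ?signr_eq0.
rewrite -scalerA -cE prod_rev // -scalerAr scalerA -exprD addnn -mul2n.
by rewrite exprM sqrrN !expr1n scale1r.
Qed.

(** Left multiplication by a generator toggles its bit in the mask, up to a scalar; hence
    [mask_spanM]. *)
Lemma mul_mask_prod s x bs : anticomm_system s -> x \in s ->
    size bs = size s ->
  exists k bs', size bs' = size s /\ x * mask_prod s bs = k *: mask_prod s bs'.
Proof.
rewrite /mask_prod; elim: s bs => // y s IH [|b bs] // [anti_s sq_s] /=.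
move: anti_s; rewrite /= => /andP[/allP ys anti_s].
have sqs : {in s, forall z, unit_square z}.
  by move=> z sz; apply: sq_s; rewrite inE sz orbT.
rewrite inE; case: eqP => [-> _|_ /= sx] [size_bs].
  have [c _ cE] := sq_s y (mem_head _ _); case: b.
    exists c, (false :: bs); rewrite /= size_bs; split=> //.
    by rewrite big_cons mulrA cE mulr_algl.
  exists 1, (true :: bs); rewrite /= size_bs; split=> //.
  by rewrite big_cons scale1r.
have [k [bs' [size_bs' IHx]]] := IH bs (conj anti_s sqs) sx size_bs.
case: b; last by exists k, (false :: bs'); rewrite /= size_bs'.
have xy : anticomm x y by rewrite anticomm_sym ys.
exists (- k), (true :: bs'); rewrite /= size_bs'; split=> //.
by rewrite !big_cons mulrA (eqP xy) mulNr -mulrA IHx -scalerAr scaleNr.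
Qed.

Definition mask_span s x : Prop :=
  exists c : (size s).-tuple bool -> K, x = \sum_t c t *: mask_prod s t.

Lemma mask_span_linear s k x y :
  mask_span s x -> mask_span s y -> mask_span s (k *: x + y).
Proof.
move=> [c ->] [d ->]; exists (fun t => k * c t + d t).
rewrite scaler_sumr -big_split /=; apply: eq_bigr => t _.
by rewrite scalerDl scalerA.
Qed.

Lemma mask_span0 s : mask_span s 0.
Proof. by exists (fun=> 0); rewrite big1 // => t _; rewrite scale0r. Qed.

Lemma mask_spanZ s k x : mask_span s x -> mask_span s (k *: x).
Proof. by move=> sx; rewrite -[_ *: _]addr0; apply/mask_span_linear/mask_span0. Qed.

Lemma mask_span_sum s (I : Type) (r : seq I) (F : I -> A) :
  (forall i, mask_span s (F i)) -> mask_span s (\sum_(i <- r) F i).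
Proof.
move=> sF; elim/big_ind: _ => //; first exact: mask_span0.
by move=> x y sx sy; rewrite -[x]scale1r; apply: mask_span_linear.
Qed.

Lemma mask_span_prod s bs : size bs = size s -> mask_span s (mask_prod s bs).
Proof.
move=> size_bs; exists (fun t => (val t == bs)%:R).
have bsP : size bs == size s by apply/eqP.
rewrite (bigD1 (Tuple bsP)) //= eqxx scale1r big1 ?addr0 // => t.
by rewrite -val_eqE /= => /negPf->; rewrite scale0r.
Qed.

Lemma mask_span1 s : mask_span s 1.
Proof.
have := @mask_span_prod s (nseq (size s) false) (size_nseq _ _).
by rewrite /mask_prod mask_false big_nil.
Qed.

Lemma mask_spanM s x y : anticomm_system s -> x \in s ->
  mask_span s y -> mask_span s (x * y).
Proof.
move=> sys_s sx [c ->]; rewrite mulr_sumr; apply: mask_span_sum => t.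
have [k [bs' [size_bs' e]]] := mul_mask_prod sys_s sx (size_tuple t).
by rewrite -scalerAr e; do 2! apply: mask_spanZ; apply: mask_span_prod.
Qed.

End AnticommutingSystems.

Arguments anticomm {K A} x y.

(** * Linear independence of the products of sublists *)

Section MaskProductBasis.
Variables (K : fieldType) (A : falgType K).
Hypothesis char2 : (2%:R : K) != 0.
Implicit Types (x y z : A) (s r : seq A).

Lemma unit_square_unitr x : unit_square x -> x \is a GRing.unit.
Proof.
move=> [c c0 cE]; apply/unitrP; exists (c^-1 *: x).
by rewrite -scalerAl -scalerAr cE scalerA mulVf // scale1r.
Qed.

Lemma anticomm_irr x : x \is a GRing.unit -> ~~ anticomm x x.
Proof.
move=> Ux; apply/negP; rewrite /anticomm -addr_eq0 -mulr2n -scaler_nat scaler_eq0.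
rewrite (negPf char2) /= => /eqP xx0.
by have := unitr0 A; rewrite -xx0 unitrMl ?Ux.
Qed.

Lemma anticomm_system_uniq s : anticomm_system s -> uniq s.
Proof.
elim: s => //= x s IH [] /= /andP[/allP xs anti_s] sq_s.
rewrite IH ?andbT; last first.
  by split=> // y sy; apply: sq_s; rewrite inE sy orbT.
apply/negP => sx; have := xs x sx; apply/negP/anticomm_irr.
by apply: unit_square_unitr; apply: sq_s; rewrite mem_head.
Qed.

Lemma anticomm_system_neq s x y : anticomm_system s ->
  x \in s -> y \in s -> y != x -> anticomm x y.
Proof.
move=> [+ _]; elim: s => //= z s IH /andP[/allP zs anti_s].
rewrite !inE => /orP[/eqP->|sx] /orP[/eqP->|sy]; rewrite ?eqxx //.
- by move=> _; apply: zs.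
- by move=> _; rewrite anticomm_sym; apply: zs.
- exact: IH.
Qed.

Lemma mask_uniq_inj s (t t' : (size s).-tuple bool) : uniq s ->
  {in s, forall x, (x \in mask t s) = (x \in mask t' s)} -> t = t'.
Proof.
move=> Us eq_tt'; apply/val_inj/(@eq_from_nth _ false); rewrite !size_tuple // => i lti.
have /eq_tt' : nth 0 s i \in s by rewrite mem_nth.
by rewrite !in_mask // mem_nth //= index_uniq.
Qed.

Definition conj_sign x s (bs : seq bool) := odd (count (predC1 x) (mask bs s)).

(** The sign of [x] against a sublist product is the parity of the sublist plus the membership of
    [x]. If the parities agree, so do the masks. Otherwise the masks are complementary, which is
    absurd: complements in a list of even size have the same parity. *)
Lemma conj_sign_inj s (t t' : (size s).-tuple bool) : uniq s -> ~~ odd (size s) ->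
  {in s, forall x, conj_sign x s t = conj_sign x s t'} -> t = t'.
Proof.
move=> Us even_s eq_tt'.
have signE x (u : (size s).-tuple bool) :
    conj_sign x s u = odd (count id u) (+) (x \in mask u s).
  have := count_predC (pred1 x) (mask u s).
  rewrite size_mask ?size_tuple // => <-; rewrite oddD.
  rewrite count_uniq_mem ?mask_uniq // oddb.
  by rewrite /conj_sign addbC addKb.
have [eq_odd|neq_odd] := eqVneq (odd (count id t)) (odd (count id t')).
  apply: mask_uniq_inj => // x sx; have := eq_tt' x sx.
  by rewrite !signE eq_odd => /addbI.
have tE : map negb t = t' :> seq bool.
  apply: (@eq_from_nth _ false); rewrite size_map !size_tuple // => i lti.
  rewrite (nth_map false) ?size_tuple //.
  have := eq_tt' _ (mem_nth 0 lti).
  rewrite !signE !in_mask // !mem_nth //= !index_uniq //.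
  by move: neq_odd; do 2! case: (odd _); do 2! case: (nth _ _ _).
have := count_predC id t; rewrite size_tuple => /(congr1 odd).
rewrite oddD (negPf even_s) (@eq_count _ (predC id) (preim negb id)) // -count_map tE.
by move: neq_odd; do 2! case: (odd _).
Qed.

(** For [x] with nonzero scalar square this is twice the projection of [y] to the centralizer of
    [x]: it doubles what commutes with [x] and kills what anticommutes with it. *)
Definition conj_avg x y : A := y + x^-1 * y * x.

Lemma conj_avg_is_linear x : linear (conj_avg x).
Proof.
move=> k y z; rewrite /conj_avg mulrDr mulrDl -scalerAr -scalerAl scalerDr.
by rewrite addrACA.
Qed.
HB.instance Definition _ x :=
  GRing.isLinear.Build K A A *:%R (conj_avg x) (conj_avg_is_linear x).

Lemma foldr_conj_avg_sum s (I : finType) (c : I -> K) (F : I -> A) :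
  foldr conj_avg (\sum_i c i *: F i) s = \sum_i c i *: foldr conj_avg (F i) s.
Proof.
elim: s => //= x s ->; rewrite linear_sum.
by apply: eq_bigr => i _; rewrite linearZ.
Qed.

Lemma foldr_conj_avg s y (b : A -> bool) :
  {in s, forall x, unit_square x /\ x * y = (-1) ^+ b x *: (y * x)} ->
  foldr conj_avg y s = if has b s then 0 else 2 ^+ size s *: y.
Proof.
elim: s => [|x s IH] xs /=; first by rewrite scale1r.
rewrite IH => [|z sz]; last by apply: xs; rewrite inE sz orbT.
have [/unit_square_unitr Ux xy] := xs x (mem_head _ _).
have xyE : x^-1 * y * x = (-1) ^+ b x *: y.
  apply: (mulrI Ux); rewrite -!mulrA mulVKr // -scalerAr xy scalerA.
  by rewrite -signr_addb addbb scale1r.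
case: (has b s) => /=; first by rewrite orbT linear0.
rewrite orbF linearZ /= /conj_avg xyE.
case: (b x); first by rewrite expr1 scaleN1r subrr scaler0.
by rewrite expr0 scale1r exprS mulrC -scalerA -mulr2n scaler_nat.
Qed.

(* The averages over all x in s kill every m_t m_u but m_t m_t, because m_u is
   determined by its commutation signs with s when s has even size. *)
Lemma mask_prod_free s (c : (size s).-tuple bool -> K) :
    anticomm_system s -> ~~ odd (size s) ->
  \sum_t c t *: mask_prod s t = 0 -> forall t, c t = 0.
Proof.
move=> sys_s even_s sum0 t; have Us := anticomm_system_uniq sys_s.
have [anti_s sq_s] := sys_s.
have xm x (u : (size s).-tuple bool) : x \in s ->
    x * mask_prod s u = (-1) ^+ conj_sign x s u *: (mask_prod s u * x).
  move=> sx; rewrite /conj_sign signr_odd; apply: mul_prod_sign => y /mem_mask sy.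
  exact: anticomm_system_neq sys_s _ sy.
have : \sum_u c u *: (mask_prod s t * mask_prod s u) = 0.
  transitivity (mask_prod s t * \sum_u c u *: mask_prod s u).
    by rewrite mulr_sumr; apply: eq_bigr => u _; rewrite scalerAr.
  by rewrite sum0 mulr0.
move/(congr1 (fun y => foldr conj_avg y s)).
pose b (u : (size s).-tuple bool) x := conj_sign x s t (+) conj_sign x s u.
have avgE (u : (size s).-tuple bool) : foldr conj_avg (mask_prod s t * mask_prod s u) s =
    if has (b u) s then 0 else 2 ^+ size s *: (mask_prod s t * mask_prod s u).
  apply: foldr_conj_avg => x sx; split; first exact: sq_s.
  rewrite mulrA (xm x t) // -scalerAl -(mulrA _ x) (xm x u) // -scalerAr scalerA mulrA.
  by rewrite -signr_addb.
rewrite foldr_conj_avg_sum (bigD1 t) //= avgE.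
have -> : has (b t) s = false.
  by apply/negP => /hasP[x _]; rewrite /b addbb.
rewrite big1 => [|u neq_ut]; last first.
  rewrite avgE; case: ifP => [|/hasPn eq_ut]; first by rewrite scaler0.
  case/eqP: neq_ut; apply/esym/(conj_sign_inj Us even_s) => x sx.
  by have := eq_ut x sx; rewrite /b -negb_eqb negbK => /eqP.
have /= [d d0 dE] : unit_square (mask_prod s t).
  apply: unit_square_prod; first exact: pairwise_mask.
  by move=> x /mem_mask; apply: sq_s.
have -> : foldr conj_avg 0 s = 0 :> A by elim: (s) => //= x r ->; rewrite linear0.
rewrite addr0 dE !scalerA => /eqP; rewrite scaler_eq0 oner_eq0 orbF.
by rewrite !mulf_eq0 (negPf d0) expf_eq0 (negPf char2) andbF !orbF => /eqP.
Qed.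

(** A free family of the right cardinality is a basis. The index type is arbitrary so that masks can
    index the sublist products; the functions [X] are the coordinates. *)
Lemma free_family_coord (I : finType) (F : I -> A) : #|I| = \dim {:A} ->
    (forall c : I -> K, \sum_i c i *: F i = 0 -> forall i, c i = 0) ->
  exists X : I -> {scalar A}, (forall i, X i (F i) = 1) /\
    forall x, x = \sum_i X i x *: F i.
Proof.
move=> cardI freeF; pose B := [tuple F (enum_val i) | i < #|I|].
have BE i : B`_(enum_rank i) = F i.
  by rewrite -(tnth_nth 0 B) tnth_mktuple enum_rankK.
have sumE (k : 'I_#|I| -> K) :
    \sum_(i < #|I|) k i *: B`_i = \sum_i k (enum_rank i) *: F i.
  rewrite (reindex (@enum_rank I)) /=; last exact/onW_bij/enum_rank_bij.
  by apply: eq_bigr => i _; rewrite BE.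
have freeB : free B.
  apply/freeP => k; rewrite sumE => /freeF k0 i.
  by have := k0 (enum_val i); rewrite enum_valK.
exists (fun i => coord B (enum_rank i)); split=> [i|x].
  by rewrite /= -BE coord_free // eqxx.
suff /coord_span : x \in <<B>>%VS by rewrite sumE.
suff -> : <<B>>%VS = {:A}%VS by rewrite memvf.
apply/eqP; rewrite eqEdim subvf -cardI.
by move: freeB; rewrite /free size_tuple => /eqP->; apply: leqnn.
Qed.

End MaskProductBasis.

(** * Clifford algebras of diagonal forms *)

Section DiagonalQuadraticSpace.
Variables (K : fieldType) (m : nat) (c : 'I_m -> K).

Definition diag_form (x : 'rV[K]_m) : K := \sum_i c i * x 0 i ^+ 2.

Lemma diag_form_polar x y : polar diag_form x y = \sum_i 2%:R * (c i * x 0 i * y 0 i).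
Proof.
rewrite /polar /diag_form -!sumrB; apply: eq_bigr => i _.
by rewrite !mxE; ring.
Qed.

Lemma diag_formP : quadratic_form diag_form.
Proof.
split=> [a x|y a x z].
  rewrite /diag_form mulr_sumr; apply: eq_bigr => i _; rewrite !mxE; ring.
rewrite !diag_form_polar mulr_sumr -big_split /=.
by apply: eq_bigr => i _; rewrite !mxE; ring.
Qed.

Definition diag_space : quadSpace K := QuadSpace diag_formP.

Lemma dim_diag_space : \dim {:diag_space} = m.
Proof. by rewrite dimvf; exact: mul1n. Qed.

Lemma bform_diag_space (x y : diag_space) : (2%:R : K) != 0 ->
  bform x y = \sum_i c i * (x : 'rV_m) 0 i * (y : 'rV_m) 0 i.
Proof.
move=> char2; rewrite /bform [polar _ _ _]diag_form_polar mulr_sumr.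
by apply: eq_bigr => i _; rewrite mulKf.
Qed.

End DiagonalQuadraticSpace.

Lemma clifford_inj_polar (K : fieldType) (V : quadSpace K) (x y : V) :
  clifford_inj x * clifford_inj y + clifford_inj y * clifford_inj x =
  (polar (@qform K V) x y)%:A.
Proof.
rewrite /polar !scalerBl -!clifford_inj_sqr linearD mulrDl !mulrDr.
by apply/esym/eqP; rewrite !subr_eq [X in _ == X]addrC !addrA.
Qed.

Section CliffordOfSystem.
Variables (K : fieldType) (A : falgType K) (s : seq A) (c : 'I_(size s) -> K).
Hypothesis char2 : (2%:R : K) != 0.
Hypotheses (sys_s : anticomm_system s) (even_s : ~~ odd (size s)).
Hypothesis dimA : \dim {:A} = (2 ^ size s)%N.
Hypothesis sqrc : forall i : 'I_(size s), s`_i * s`_i = (c i)%:A.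

(** The linear map on the diagonal space that extends to the isomorphism from the Clifford algebra
    to [A]. *)
Definition system_comb (x : 'rV[K]_(size s)) : A := \sum_i x 0 i *: s`_i.

Lemma system_comb_is_linear : linear system_comb.
Proof.
move=> k x y; rewrite /system_comb scaler_sumr -big_split /=.
by apply: eq_bigr => i _; rewrite !mxE scalerDl scalerA.
Qed.
HB.instance Definition _ := GRing.isLinear.Build K 'rV[K]_(size s) A *:%R
  system_comb system_comb_is_linear.

Lemma system_comb_delta i : system_comb (delta_mx 0 i) = s`_i.
Proof.
rewrite /system_comb (bigD1 i) //= mxE !eqxx scale1r big1 ?addr0 // => j neq_ji.
by rewrite mxE (negPf neq_ji) scale0r.
Qed.

Lemma system_anticomm (i j : 'I_(size s)) : j != i -> anticomm s`_i s`_j.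
Proof.
move=> neq_ij; apply: anticomm_system_neq sys_s _ _ _; rewrite ?mem_nth //.
by rewrite nth_uniq // (anticomm_system_uniq char2).
Qed.

Lemma system_comb_sqr x :
  system_comb x * system_comb x = (diag_form c x)%:A.
Proof.
have sqE : system_comb x * system_comb x =
    \sum_i \sum_j (x 0 i * x 0 j) *: (s`_i * s`_j).
  rewrite {1}/system_comb mulr_suml; apply: eq_bigr => i _.
  rewrite mulr_sumr; apply: eq_bigr => j _.
  by rewrite -scalerAl -scalerAr scalerA.
(* The square is doubled and the sums are exchanged in one copy, so that each [s_i s_j] with
   [i != j] meets [s_j s_i] and cancels. *)
apply: (scalerI char2); rewrite scaler_nat mulr2n {1}sqE sqE.
rewrite [X in _ + X]exchange_big -big_split /diag_form scaler_suml scaler_sumr.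
apply: eq_bigr => i _; rewrite -big_split (bigD1 i) //= big1 => [|j neq_ji].
  by rewrite addr0 sqrc -scalerDl !scalerA; congr (_ *: _); ring.
have /eqP -> := system_anticomm neq_ji.
by rewrite mulrC scalerN addNr.
Qed.

Lemma sqrc_neq0 i : c i != 0.
Proof.
apply: contraTneq (mem_nth 0 (ltn_ord i)) => ci0; apply/negP => si.
have [_ /(_ _ si)[d d0 dE]] := sys_s.
move: dE; rewrite sqrc ci0 scale0r => /esym/eqP.
by rewrite scaler_eq0 (negPf d0) oner_eq0.
Qed.

Notation V := (diag_space c).

Definition clifford_gens : seq (clifford V) :=
  [seq clifford_inj (delta_mx 0 i : V) | i <- enum 'I_(size s)].

Lemma diag_form_delta i : diag_form c (delta_mx 0 i) = c i.
Proof.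
rewrite /diag_form (bigD1 i) //= mxE !eqxx expr1n mulr1 big1 ?addr0 // => j neq_ji.
by rewrite mxE (negPf neq_ji) expr0n mulr0.
Qed.

Lemma clifford_gens_system : anticomm_system clifford_gens.
Proof.
split.
  rewrite pairwise_map; have := enum_uniq 'I_(size s); rewrite uniq_pairwise.
  apply: sub_pairwise => i j /= neq_ij; rewrite /anticomm -addr_eq0.
  rewrite clifford_inj_polar [polar _ _ _]diag_form_polar big1 ?scale0r // => k _.
  rewrite !mxE /=; case: (eqVneq k i) => [->|_]; last by rewrite mulr0 mul0r mulr0.
  by rewrite (negPf neq_ij) !mulr0.
move=> _ /mapP[i _ ->]; exists (c i); first exact: sqrc_neq0.
by rewrite clifford_inj_sqr [qform _]diag_form_delta.
Qed.

(** [clifford_ind] builds every element by linear combinations and left multiplications by vectors,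
    and each vector is a combination of the generators. *)
Lemma clifford_gens_span a : mask_span clifford_gens a.
Proof.
elim/clifford_ind: a => [|k a b|x a sa].
- exact: mask_span1.
- exact: mask_span_linear.
rewrite (row_sum_delta x) linear_sum mulr_suml; apply: mask_span_sum => i.
rewrite linearZ -scalerAl; apply/mask_spanZ/mask_spanM => //.
  exact: clifford_gens_system.
by apply/mapP; exists i; rewrite ?mem_enum.
Qed.

(** The universal property gives [g], which sends sublist products of the generators to those of
    [s]. The former span the Clifford algebra and the latter are free, so [g] is injective; by
    [dimA] the latter form a basis of [A], so [g] is surjective. *)
Lemma clifford_system_iso :
  exists2 g : {lrmorphism clifford V -> A}, bijective g &
    forall x : V, g (clifford_inj x) = system_comb x.
Proof.
have [g gE] := @clifford_lift K V A system_comb system_comb_sqr.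
exists g => //; have mapg : map g clifford_gens = s.
  rewrite /clifford_gens -map_comp.
  apply: (@eq_from_nth _ 0); rewrite size_map size_enum_ord // => i lti.
  rewrite (nth_map (Ordinal lti)) ?size_enum_ord //=.
  by rewrite gE [LHS]system_comb_delta nth_enum_ord.
have gprod bs : g (mask_prod clifford_gens bs) = mask_prod s bs.
  transitivity (mask_prod (map g clifford_gens) bs); last by rewrite mapg.
  by rewrite /mask_prod rmorph_prod -[in RHS]map_mask [RHS]big_map.
have gsum (k : (size clifford_gens).-tuple bool -> K) :
    g (\sum_t k t *: mask_prod clifford_gens t) = \sum_t k t *: mask_prod s t.
  by rewrite linear_sum; apply: eq_bigr => t _; rewrite linearZ /= gprod.
have size_gens : size clifford_gens = size s by rewrite size_map size_enum_ord.
have freeg (k : (size clifford_gens).-tuple bool -> K) :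
    \sum_t k t *: mask_prod s t = 0 -> forall t, k t = 0.
  rewrite size_gens in k *; exact: mask_prod_free.
have ginj : injective g.
  apply: raddf_inj => a; have [k ->] := clifford_gens_span a.
  move=> /(etrans (esym (gsum k)))/freeg k0.
  by apply: big1 => t _; rewrite k0 scale0r.
have gsurj y : exists a, g a == y.
  have [|X [_ XE]] := free_family_coord _ freeg.
    by rewrite card_tuple card_bool dimA size_gens.
  exists (\sum_t X t y *: mask_prod clifford_gens t); apply/eqP.
  by rewrite gsum -XE.
exists (fun y => xchoose (gsurj y)) => [a|y]; last exact/eqP/(xchooseP (gsurj y)).
by apply: ginj; apply/eqP/(xchooseP (gsurj (g a))).
Qed.

(** The required involution of the Clifford algebra is [sigma] transported along the isomorphism. *)
Lemma isom_clifford_system (sigma : A -> A) (t : 'End(V)) :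
  first_kind_involution sigma ->
  (forall x : V, sigma (system_comb x) = system_comb (t x)) ->
  isom_clifford sigma t.
Proof.
move=> [sL sM sK] st; have [g [h gK hK] gE] := clifford_system_iso.
have hL : linear h by move=> k x y; rewrite -[RHS]gK linearP /= !hK.
have hM : monoid_morphism h.
  split=> [|x y]; first by rewrite -[RHS]gK rmorph1.
  by rewrite -[RHS]gK rmorphM /= !hK.
pose mL := GRing.isLinear.Build K A (clifford V) *:%R h hL.
pose mM := GRing.isMonoidMorphism.Build A (clifford V) h hM.
pose H : {lrmorphism A -> clifford V} := HB.pack h mL mM.
exists (fun a => h (sigma (g a))); last first.
  by exists H => [|x] /=; [exists g | rewrite hK].
split; last by move=> x; rewrite gE st -gE gK.
split=> [k a b|a b|a]; last by rewrite hK sK gK.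
  by rewrite linearP /= sL hL.
by rewrite rmorphM /= sM hM.2.
Qed.

End CliffordOfSystem.

(** * The trace of an involution *)

(** Basis independence of the trace: both sides equal the double sum of [Y j (x i) * X i (T (y j))].
    It serves over [K] in [A] and over [L] in the matrices. *)
Lemma coord_trace_indep (F : fieldType) (W : lmodType F) (I J : finType)
    (x : I -> W) (X : I -> {scalar W}) (y : J -> W) (Y : J -> {scalar W})
    (T : {linear W -> W}) :
  (forall w, w = \sum_i X i w *: x i) -> (forall w, w = \sum_j Y j w *: y j) ->
  \sum_i X i (T (x i)) = \sum_j Y j (T (y j)).
Proof.
move=> Xx Yy.
under eq_bigr => i _ do rewrite {1}[x i]Yy !linear_sum.
rewrite exchange_big; apply: eq_bigr => j _.
rewrite [in RHS](Xx (T (y j))) linear_sum; apply: eq_bigr => i _.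
by rewrite !linearZ /= mulrC.
Qed.

Lemma bilinear_mx_inj (L : fieldType) m (B C : 'M[L]_m) :
  (forall u v : 'cV_m, (u^T *m B *m v) 0 0 = (u^T *m C *m v) 0 0) -> B = C.
Proof.
move=> eqBC; apply/matrixP => i j.
have := eqBC (delta_mx i 0) (delta_mx j 0).
by rewrite trmx_delta -!rowE -!colE !mxE.
Qed.

Definition coord_trace (K : fieldType) (A : vectType K) (s : A -> A) : K :=
  \sum_(i < \dim {:A}) coord (vbasis {:A}) i (s (vbasis {:A})`_i).

Lemma coord_trace_diag (K : fieldType) (A : falgType K) (I : finType)
    (F : I -> A) (eps : I -> K) (s : {linear A -> A}) :
    #|I| = \dim {:A} ->
    (forall c : I -> K, \sum_i c i *: F i = 0 -> forall i, c i = 0) ->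
    (forall i, s (F i) = eps i *: F i) ->
  coord_trace s = \sum_i eps i.
Proof.
move=> cardI freeF sF; have [X [XF XE]] := free_family_coord cardI freeF.
rewrite /coord_trace.
rewrite (coord_trace_indep (Y := X) (y := F) (X := fun i => coord (vbasis {:A}) i)) //.
  by apply: eq_bigr => i _; rewrite sF linearZ /= XF mulr1.
by move=> w; apply/coord_vbasis/memvf.
Qed.

(** Over the splitting field the involution becomes [w -> g^-1 w^T g], whose trace is computed on
    the matrix units. The image under [iota] of the trace over [K] is the trace over [L]. *)
Lemma adjoint_coord_trace (K : fieldType) (A : falgType K)
    (s : {linear A -> A}) (L : fieldType) m (g : 'M[L]_m) (e : L) :
  g \in unitmx -> g^T = e *: g -> adjoint_after_splitting s g ->
  (m * m = \dim {:A})%N /\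
  exists iota : {rmorphism K -> L}, iota (coord_trace s) = e * m%:R.
Proof.
move=> Ug gT [iota [phi [[phiL phi1 phiM phi_bij] adj]]].
(* By [splitting], [b] is an [L]-basis of the matrices; the inverse [h] of the bijection gives the
   coordinates. *)
pose b i := phi (vbasis {:A})`_i.
pose f (c : 'rV[L]_(\dim {:A})) := \sum_i c 0 i *: b i.
have fL : linear f.
  move=> k c d; rewrite /f scaler_sumr -big_split /=; apply: eq_bigr => i _.
  by rewrite !mxE scalerDl scalerA.
pose fM := GRing.isLinear.Build L _ _ *:%R f fL.
pose f' : {linear 'rV[L]_(\dim {:A}) -> 'M[L]_m} := HB.pack f fM.
have [h fK hK] : bijective f' by exact: phi_bij.
have hL : linear h by move=> k x y; rewrite -[RHS]fK linearP !hK.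
pose X i (w : 'M[L]_m) : L := h w 0 i.
have XL i : scalar (X i) by move=> k x y; rewrite /X hL !mxE.
pose XM i := GRing.isLinear.Build L _ _ *%R (X i) (XL i).
pose X' i : {scalar 'M[L]_m} := HB.pack (X i) (XM i).
have Xb w : w = \sum_i X' i w *: b i by rewrite -[LHS]hK.
have kerf : ({:'rV[L]_(\dim {:A})} :&: lker (linfun f') = 0)%VS.
  apply/eqP; rewrite -subv0; apply/subvP => c.
  rewrite memv_cap memv_ker lfunE /= memv0 => /andP[_ /eqP c0].
  by apply/eqP/(can_inj fK); rewrite linear0.
have imf : limg (linfun f') = {:'M[L]_m}%VS.
  apply/eqP; rewrite eqEsubv subvf; apply/subvP => w _.
  by rewrite -[w]hK -(lfunE f') memv_img ?memvf.
have dimE : (m * m = \dim {:A})%N.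
  transitivity (\dim {:'M[L]_m}); first by rewrite dimvf dim_matrix.
  rewrite -imf (limg_dim_eq kerf); move: (\dim {:A}) => N.
  by rewrite dimvf dim_matrix; exact: mul1n.
split=> //; exists iota.
have phiZ k x : phi (k *: x) = iota k *: phi x.
  have phi0 : phi 0 = 0.
    have := phiL (-1) 0 0; rewrite scaler0 addr0 rmorphN1 scaleN1r addrC.
    by rewrite subrr.
  by have := phiL k x 0; rewrite addr0 phi0 addr0.
have phi_sum (I : finType) (k : I -> K) (x : I -> A) :
    phi (\sum_i k i *: x i) = \sum_i iota (k i) *: phi (x i).
  elim/big_rec2: _ => [|i y z _ <-]; last by rewrite phiL.
  by have := phiZ 0 0; rewrite scale0r rmorph0 scale0r.
(* Adjointness, tested on all pairs of vectors, determines the matrix of [s x]. *)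
have adjE x : phi (s x) = invmx g *m (phi x)^T *m g.
  rewrite -mulmxA; suff <- : g *m phi (s x) = (phi x)^T *m g by rewrite mulKmx.
  apply: bilinear_mx_inj => u v; have := adj x u v.
  by rewrite /gram_form trmx_mul !mulmxA.
pose T (w : 'M[L]_m) := invmx g *m w^T *m g.
have TL : linear T.
  by move=> k x y; rewrite /T linearP mulmxDr mulmxDl -scalemxAr -scalemxAl.
pose TM := GRing.isLinear.Build L _ _ *:%R T TL.
pose T' : {linear 'M[L]_m -> 'M[L]_m} := HB.pack T TM.
(* The second basis is that of the matrix units, with the entries as coordinates. *)
pose Y (p : 'I_m * 'I_m) (w : 'M[L]_m) : L := w p.1 p.2.
have YL p : scalar (Y p) by move=> k x y; rewrite /Y !mxE.
pose YM p := GRing.isLinear.Build L _ _ *%R (Y p) (YL p).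
pose Y' p : {scalar 'M[L]_m} := HB.pack (Y p) (YM p).
have Yd w : w = \sum_p Y' p w *: delta_mx p.1 p.2.
  by rewrite {1}[w]matrix_sum_delta pair_big.
have := coord_trace_indep T' Xb Yd.
(* [phi] turns coordinates in the chosen basis of [A] into coordinates in [b], through [iota]. *)
have -> : \sum_i X' i (T' (b i)) = iota (coord_trace s).
  rewrite /coord_trace rmorph_sum; apply: eq_bigr => i _.
  rewrite /= /T /b -adjE {1}(coord_vbasis (memvf (s _))) phi_sum.
  rewrite (_ : \sum_j _ = f (\row_j iota (coord (vbasis {:A}) j (s (vbasis {:A})`_i)))).
    by rewrite /X [h _]fK mxE.
  by apply: eq_bigr => j _; rewrite mxE.
move=> ->; rewrite -(pair_bigA _ (fun p q => Y' (p, q) (T' (delta_mx p q)))) /=.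
(* The [(p, q)] entry of [g^-1 E_qp g] is [(g^-1)_pq g_pq], and [g_pq = e g_qp]. *)
transitivity (\sum_p \sum_q e * (invmx g p q * g q p)).
  apply: eq_bigr => p _; apply: eq_bigr => q _; rewrite /Y /T trmx_delta /=.
  have gE : g p q = e * g q p by have := congr1 (fun B : 'M_m => B q p) gT; rewrite !mxE.
  have dE k : (invmx g *m delta_mx q p) p k = invmx g p q * (k == p)%:R.
    rewrite mxE (bigD1 q) //= big1 => [|l neq_lq].
      by rewrite addr0 mxE eqxx.
    by rewrite mxE (negPf neq_lq) mulr0.
  rewrite mulrCA -gE mxE (bigD1 p) //= big1 => [|k neq_kp].
    by rewrite addr0 dE eqxx mulr1.
  by rewrite dE (negPf neq_kp) mulr0 mul0r.
transitivity (e * \tr (invmx g *m g)).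
  rewrite /mxtrace mulr_sumr; apply: eq_bigr => p _.
  by rewrite mxE mulr_sumr.
by rewrite mulVmx // mxtrace1.
Qed.
Lemma gram_form_tr (L : fieldType) m (g : 'M[L]_m) (u v : 'cV_m) :
  (u^T *m g^T *m v) 0 0 = gram_form g v u.
Proof. by rewrite /gram_form -[v^T *m g *m u]trmxK [RHS]mxE !trmx_mul trmxK mulmxA. Qed.

Section InvolutionTrace.
Variables (K : fieldType) (A : falgType K) (s : {linear A -> A}) (n : nat).
Hypothesis dimA : \dim {:A} = (2 ^ (2 * n))%N.

(** The case [e = 1]; the degree [m] is [2 ^ n] because its square is [2 ^ (2 * n)]. *)
Lemma orthogonal_coord_trace : orthogonal_involution s -> coord_trace s = 2 ^+ n.
Proof.
move=> [L [m [g [Ug g_sym /(adjoint_coord_trace Ug (e := 1))]]]].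
have gT : g^T = 1 *: g.
  by rewrite scale1r; apply: bilinear_mx_inj => u v; rewrite gram_form_tr g_sym.
move=> /(_ gT)[mm [iota trE]]; apply: (fmorph_inj iota).
rewrite trE mul1r rmorphXn /= rmorph_nat -natrX; congr _%:R.
by apply/eqP; rewrite -(eqn_exp2r _ _ (isT : 0 < 2)%N) -expnM mulnC -dimA -mm mulnn.
Qed.

(** The case [e = -1]: expanding an alternating form at [u + v] shows that its Gram matrix is
    antisymmetric. *)
Lemma symplectic_coord_trace : symplectic_involution s -> coord_trace s = - 2 ^+ n.
Proof.
move=> [L [m [g [Ug g_alt /(adjoint_coord_trace Ug (e := -1))]]]].
have gT : g^T = -1 *: g.
  rewrite scaleN1r; apply: bilinear_mx_inj => u v; rewrite gram_form_tr.
  have mxD (B C : 'M[L]_1) : (B + C) 0 0 = B 0 0 + C 0 0 by rewrite mxE.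
  have gD : gram_form g (u + v) (u + v) =
      gram_form g u u + gram_form g u v + (gram_form g v u + gram_form g v v).
    by rewrite /gram_form [(u + v)^T]linearD !mulmxDl !mulmxDr !mxD.
  move/eqP: gD; rewrite !g_alt add0r addr0 eq_sym addrC addr_eq0 => /eqP->.
  by rewrite /gram_form mulmxN mulNmx [RHS]mxE.
move=> /(_ gT)[mm [iota trE]]; apply: (fmorph_inj iota).
rewrite trE mulN1r rmorphN rmorphXn /= rmorph_nat -natrX; congr (- _%:R).
by apply/eqP; rewrite -(eqn_exp2r _ _ (isT : 0 < 2)%N) -expnM mulnC -dimA -mm mulnn.
Qed.

End InvolutionTrace.

Lemma big_bool_tuple (R : nmodType) n (F : n.+1.-tuple bool -> R) :
  \sum_t F t = \sum_(t : n.-tuple bool) F [tuple of false :: t] +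
               \sum_(t : n.-tuple bool) F [tuple of true :: t].
Proof.
pose h (p : bool * n.-tuple bool) := [tuple of p.1 :: p.2].
rewrite (reindex h) /=; last first.
  exists (fun t => (thead t, [tuple of behead t])) => [[b t] _|t _].
    by rewrite /h theadE; congr pair; apply: val_inj.
  by rewrite /h -tuple_eta.
rewrite -(pair_bigA _ (fun b t => F (h (b, t)))) /=.
by rewrite big_bool addrC.
Qed.

(** * Signs of an involution on sublist products, and their sum *)

Section SignSums.
Variables (K : fieldType) (A : algType K) (eps : A -> K).
Implicit Types (x : A) (r s : seq A).

Definition prod_sign r : K := \prod_(x <- r) eps x * (-1) ^+ 'C(size r, 2).

Lemma prod_sign_cons x r :
  prod_sign (x :: r) = eps x * ((-1) ^+ size r * prod_sign r).
Proof. by rewrite /prod_sign big_cons /= binS bin1 exprD; ring. Qed.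

(** The involution reverses the factors and scales each of them; undoing the reversal with
    [prod_rev] gives the binomial sign. *)
Lemma involution_prod (sigma : A -> A) r : first_kind_involution sigma ->
    pairwise anticomm r -> {in r, forall x, sigma x = eps x *: x} ->
  sigma (\prod_(x <- r) x) = prod_sign r *: \prod_(x <- r) x.
Proof.
move=> [sL sM sK] anti_r sr.
have s1 : sigma 1 = 1 by rewrite -[LHS]mulr1 -{2}[1]sK -sM mulr1 sK.
have sZ k x : sigma (k *: x) = k *: sigma x.
  have s0 : sigma 0 = 0 by have := sL (-1) 0 0; rewrite scaler0 addr0 scaleN1r addNr.
  by have := sL k x 0; rewrite s0 !addr0.
rewrite /prod_sign -scalerA -prod_rev // => {anti_r}.
elim: r sr => [|x r IH] sr; first by rewrite !big_nil scale1r.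
rewrite rev_cons -cats1 big_cat big_seq1 /= !big_cons sM (sr x) ?mem_head //.
rewrite IH => [|z sz]; last by apply: sr; rewrite inE sz orbT.
by rewrite -scalerAl -scalerAr scalerA mulrC.
Qed.

(** With a formal square root [i] of -1, the two components are the imaginary and the real part, in
    this order, of [(1 + i)] times the product of the [1 + e i]. *)
Fixpoint sign_sums (es : seq K) : K * K :=
  if es is e :: es' then
    let p := sign_sums es' in (p.1 + e * p.2, p.2 - e * p.1)
  else (1, 1).

(* The second component, the sum weighted by (-1)^|t|, makes the recursion
   closed. *)
Lemma sign_sumsE s :
  sign_sums (map eps s) =
  (\sum_(t : (size s).-tuple bool) prod_sign (mask t s),
   \sum_(t : (size s).-tuple bool)
     (-1) ^+ size (mask t s) * prod_sign (mask t s)).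
Proof.
elim: s => [|x s IH] /=.
  have sum0 (F : 0.-tuple bool -> K) : \sum_t F t = F [tuple].
    by rewrite (bigD1 [tuple]) //= big1 ?addr0 // => t; rewrite tuple0.
  by rewrite !sum0 /prod_sign big_nil !mulr1.
rewrite IH /= !big_bool_tuple /=; congr pair.
  by congr (_ + _); rewrite mulr_sumr; apply: eq_bigr => t _; rewrite prod_sign_cons.
congr (_ + _); rewrite mulr_sumr -sumrN; apply: eq_bigr => t _.
rewrite prod_sign_cons exprS.
suff : (-1) ^+ size (mask t s) * (-1) ^+ size (mask t s) = 1 :> K.
  by move: (_ ^+ _) => z zz; ring: zz.
by rewrite -expr2 sqrr_sign.
Qed.

(** The formal product is [(1 + i)^(4h + 1)], and [(1 + i)^4 = -4]. *)
Lemma sign_sums_nseq1 h : sign_sums (nseq (4 * h) 1) = ((- 4%:R) ^+ h, (- 4%:R) ^+ h).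
Proof.
elim: h => [|h IH]; first by rewrite muln0.
by rewrite mulnS /= IH /= exprS; congr pair; ring.
Qed.

(** The formal product is [(1 - i)(1 + i)^(4h + 4) = (1 - i)(-4)^(h + 1)], of which the imaginary
    part is taken. *)
Lemma sign_sums_consN1 h :
  (sign_sums (-1 :: nseq (4 * h).+3 1)).1 = - (- 4%:R) ^+ h.+1.
Proof. by rewrite /= sign_sums_nseq1 /= exprS; ring. Qed.

End SignSums.

(** The sublist products form a basis of eigenvectors, so the trace is the sum of their signs. *)
Lemma coord_trace_system (K : fieldType) (A : falgType K) (sigma : {linear A -> A})
    (s : seq A) (eps : A -> K) : (2%:R : K) != 0 ->
    first_kind_involution sigma -> anticomm_system s -> ~~ odd (size s) ->
    \dim {:A} = (2 ^ size s)%N -> {in s, forall x, sigma x = eps x *: x} ->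
  coord_trace sigma = (sign_sums (map eps s)).1.
Proof.
move=> char2 inv_sigma sys_s even_s dimA sE; rewrite sign_sumsE /=.
apply: (coord_trace_diag (F := fun t : (size s).-tuple bool => mask_prod s t)).
- by rewrite card_tuple card_bool.
- by move=> c; apply: mask_prod_free.
move=> t; apply: involution_prod => //; first exact/pairwise_mask/(proj1 sys_s).
by move=> x /mem_mask; apply: sE.
Qed.

(** * Reduction of the number of minus signs *)

(** Consequently, reversing a product of [4h] pairwise anticommuting elements costs no sign. *)
Lemma odd_bin2_mul4 h : odd 'C(4 * h, 2) = false.
Proof.
by rewrite bin2 (_ : 4 * h * _ = (2 * h * (4 * h).-1).*2)%N ?doubleK ?oddM //; lia.
Qed.

Section SignedSystems.
Variables (K : fieldType) (A : falgType K) (sigma : A -> A).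
Hypothesis char2 : (2%:R : K) != 0.
Hypothesis inv_sigma : first_kind_involution sigma.
Implicit Types (x y : A) (s N P : seq A).

Lemma pairwise_anticomm s : uniq s ->
  {in s &, forall x y, x != y -> anticomm x y} -> pairwise anticomm s.
Proof.
rewrite uniq_pairwise => Us anti_s.
exact: (sub_in_pairwise (P := mem s) (r := [rel x y | x != y])) (introT allP _) _.
Qed.

Lemma perm_anticomm_system s s' : perm_eq s s' ->
  anticomm_system s -> anticomm_system s'.
Proof.
move=> ss' sys_s; have mem_ss' := perm_mem ss'; split; last first.
  by move=> x; rewrite -mem_ss'; apply: sys_s.2.
apply: pairwise_anticomm => [|x y].
  by rewrite -(perm_uniq ss') (anticomm_system_uniq char2).
by rewrite -!mem_ss' eq_sym => sx sy; apply: anticomm_system_neq sys_s _ _.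
Qed.

Lemma anticomm_system_cat s s' : anticomm_system (s ++ s') ->
  [/\ anticomm_system s, anticomm_system s' & allrel anticomm s s'].
Proof.
rewrite /anticomm_system pairwise_cat => -[/and3P[ss' anti_s anti_s'] sq].
by split=> //; split=> // x xs; apply: sq; rewrite mem_cat xs ?orbT.
Qed.

Lemma mul_prod_notin s y : ~~ odd (size s) -> {in s, forall x, anticomm y x} ->
  y * \prod_(x <- s) x = \prod_(x <- s) x * y.
Proof.
move=> even_s ys.
by rewrite mul_prod_anticomm // -signr_odd (negPf even_s) scale1r.
Qed.

(** [y] anticommutes with every factor but itself, an odd number of them. *)
Lemma mul_prod_in s y : anticomm_system s -> ~~ odd (size s) -> y \in s ->
  y * \prod_(x <- s) x = - (\prod_(x <- s) x * y).
Proof.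
move=> sys_s even_s sy.
rewrite mul_prod_sign => [|x sx]; last exact: anticomm_system_neq sys_s _ _.
have := count_predC (pred1 y) s.
rewrite count_uniq_mem ?(anticomm_system_uniq char2) // sy add1n => /(congr1 odd).
rewrite (negPf even_s) /= => /negbFE odd_c.
by rewrite -signr_odd odd_c scaleN1r.
Qed.

(** The product [w] of the block anticommutes with the elements of [s] and commutes with those of
    [s']. Hence [x w] and [y w] multiply to [x y] times the scalar [- w^2], and anticommutation
    survives. *)
Lemma block_flip_system s s' : ~~ odd (size s) -> anticomm_system (s ++ s') ->
  anticomm_system ([seq x * \prod_(y <- s) y | x <- s] ++ s').
Proof.
move=> even_s sys; have [sys_s sys_s' /allrelP ss'] := anticomm_system_cat sys.
set w := \prod_(y <- s) y.
have ws y : y \in s -> w * y = - (y * w).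
  by move=> sy; rewrite mul_prod_in ?opprK.
have ws' y : y \in s' -> y * w = w * y.
  by move=> sy; apply: mul_prod_notin => // x sx; rewrite anticomm_sym ss'.
have [d d0 dE] : unit_square w by apply: unit_square_prod; case: sys_s.
have ww x y : y \in s -> x * w * (y * w) = - (d *: (x * y)).
  move=> sy; rewrite mulrA -(mulrA x) ws // mulrN mulNr mulrA -mulrA dE.
  by rewrite -scalerAr mulr1.
split; last first.
  move=> z; rewrite mem_cat => /orP[/mapP[x sx ->]|/(sys_s'.2)//].
  have [c c0 cE] := sys_s.2 x sx; exists (- (d * c)); first by rewrite oppr_eq0 mulf_neq0.
  by rewrite ww // cE scalerA scaleNr.
rewrite pairwise_cat sys_s'.1 andbT; apply/andP; split.
  apply/allrelP => _ y /mapP[x sx ->] sy; rewrite /anticomm -mulrA -ws' //.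
  by rewrite !mulrA (eqP (ss' _ _ sx sy)) mulNr.
apply/(pairwiseP 0) => i j; rewrite !inE size_map => lti ltj ltij.
rewrite !(nth_map 0) // /anticomm !ww ?mem_nth //.
have /(pairwiseP 0)/(_ i j lti ltj ltij)/eqP -> := sys_s.1.
by rewrite scalerN.
Qed.

(** The product of a list of even size anticommutes with each of its members, so it may take the
    place of one of them. *)
Lemma exchange_system x s : odd (size s) -> anticomm_system (x :: s) ->
  anticomm_system (\prod_(y <- x :: s) y :: s).
Proof.
move=> odd_s sys; have [_ sys_s _] := anticomm_system_cat (sys : anticomm_system ([:: x] ++ s)).
split=> [|z].
  rewrite /= sys_s.1 andbT; apply/allP => y sy; rewrite anticomm_sym /anticomm.
  by rewrite mul_prod_in //= ?odd_s // inE sy orbT.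
rewrite inE => /orP[/eqP->|/(sys_s.2)//].
by apply: unit_square_prod; case: sys.
Qed.

Definition signed_system N P : Prop :=
  [/\ anticomm_system (N ++ P), {in N, forall x, sigma x = - x}
    & {in P, forall x, sigma x = x}].

Definition minus_sign N x : K := if x \in N then -1 else 1.

Lemma signed_system_sign N P : signed_system N P ->
  {in N ++ P, forall x, sigma x = minus_sign N x *: x}.
Proof.
move=> [sys sN sP] x; rewrite mem_cat /minus_sign.
by case: ifP => [/sN->|_ /= /sP->]; rewrite ?scaleN1r ?scale1r.
Qed.

Lemma map_minus_sign N P : signed_system N P ->
  map (minus_sign N) (N ++ P) = nseq (size N) (-1) ++ nseq (size P) 1.
Proof.
move=> [sys _ _]; have := anticomm_system_uniq char2 sys.
rewrite cat_uniq => /and3P[_ /hasPn NP _].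
rewrite map_cat -(size_map (minus_sign N) N) -(size_map (minus_sign N) P).
congr (_ ++ _); apply/all_pred1P/allP => _ /mapP[x sx ->] /=.
  by rewrite /minus_sign sx.
by rewrite /minus_sign (negPf (NP x sx)).
Qed.

(** Only the minus signs count, the reversal being free for [4h] factors. The permutation allows any
    element to be put first, ready for [exchange_system]. *)
Lemma signed_system_prod N P s h : signed_system N P -> perm_eq (N ++ P) s ->
    (size N + size P)%N = (4 * h)%N ->
  sigma (\prod_(x <- s) x) = (-1) ^+ size N *: \prod_(x <- s) x.
Proof.
move=> sysNP NPs sizeNP; have sys_s := perm_anticomm_system NPs (let: And3 sys _ _ := sysNP in sys).
rewrite (involution_prod inv_sigma (eps := minus_sign N)); last first.
- by move=> x; rewrite -(perm_mem NPs); apply: signed_system_sign.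
- exact: sys_s.1.
rewrite /prod_sign -(perm_size NPs) size_cat sizeNP -signr_odd odd_bin2_mul4 mulr1.
rewrite -(perm_big _ NPs) /= -(big_map (minus_sign N) predT id) map_minus_sign //.
by rewrite big_cat /= !big_nseq !iter_mulr_1 expr1n mulr1.
Qed.

(** The product [w] of the block is fixed, so [x w] goes to [w (e x) = - e (x w)]. Blocks of four
    serve the reduction, and the whole list serves the passage between all signs +1 and all signs
    -1. *)
Lemma block_flip_sign s e h : size s = (4 * h)%N -> anticomm_system s -> e ^+ 2 = 1 ->
    {in s, forall x, sigma x = e *: x} ->
  {in [seq x * \prod_(y <- s) y | x <- s], forall x, sigma x = - e *: x}.
Proof.
move=> size_s sys_s e2 sE _ /mapP[x sx ->]; have [_ sM _] := inv_sigma.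
have even_s : ~~ odd (size s) by rewrite size_s oddM.
rewrite sM (sE x) // (involution_prod inv_sigma (eps := fun=> e)) //; last exact: sys_s.1.
rewrite /prod_sign size_s -signr_odd odd_bin2_mul4 mulr1 big_const_seq count_predT.
rewrite iter_mulr_1 size_s -[4%N]/(2 * 2)%N -mulnA exprM e2 expr1n scale1r.
by rewrite -scalerAr scaleNr mul_prod_in // scalerN opprK.
Qed.

Lemma signed_system_flip4 a b c d N P : signed_system [:: a, b, c, d & N] P ->
  exists P', size P' = (size P + 4)%N /\ signed_system N P'.
Proof.
move=> [sys sN sP]; pose s := [:: a; b; c; d].
have sys' : anticomm_system (s ++ (N ++ P)) by [].
have [sys_s _ _] := anticomm_system_cat sys'.
exists ([seq x * \prod_(y <- s) y | x <- s] ++ P).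
rewrite size_cat size_map addnC; split=> //; split.
- apply: (perm_anticomm_system _ (block_flip_system _ sys')) => //.
  exact/permPl/perm_catCA.
- by move=> x Nx; apply: sN; rewrite !inE Nx !orbT.
move=> x; rewrite mem_cat => /orP[|/sP//].
move/(block_flip_sign (s := s) (h := 1) (e := -1) (esym (muln1 4%N)) sys_s); rewrite sqrrN expr1n opprK scale1r.
apply=> // y sy; rewrite scaleN1r; apply: sN.
by rewrite -[[:: a, b, c, d & N]]/(s ++ N) mem_cat sy.
Qed.

Lemma signed_system_reduce N P h : (0 < h)%N -> signed_system N P ->
    (size N + size P)%N = (4 * h)%N ->
  exists N' P', [/\ signed_system N' P', (size N' + size P')%N = (4 * h)%N
                  & (size N' <= 1)%N].
Proof.
move=> h0; have [k] := ubnP (size N); elim: k N P => // k IH N P lekN sysNP sizeNP.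
case: N => [|a [|b [|c [|d N]]]] in lekN sysNP sizeNP *.
- by exists [::], P.
- by exists [:: a], P.
(* Two minus signs: the product of the whole list has sign [(-1)^2] and replaces [a]. *)
- have [sys sN sP] := sysNP; exists [:: b], (\prod_(y <- [:: a, b & P]) y :: P).
  split=> //.
  split=> [||x].
  + apply: (perm_anticomm_system _ (exchange_system _ sys)) => /=.
      by rewrite (perm_catCA [:: _] [:: b] P).
    by have := congr1 odd sizeNP; rewrite oddM /= negbK => ->.
  + by move=> x bx; apply: sN; rewrite inE bx orbT.
  rewrite inE => /orP[/eqP->|/sP//].
  by rewrite (signed_system_prod sysNP _ sizeNP) // sqrrN expr1n scale1r.
(* Three minus signs: [P] is not empty, as 3 is no multiple of 4. The product of the whole list has
   sign [(-1)^3]; put in place of [p], it completes a block of four to flip. *)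
- case: P => [|p P] in sysNP sizeNP *; first by move: sizeNP => /=; lia.
  have [sys sN sP] := sysNP.
  have permNP : perm_eq ([:: a; b; c] ++ p :: P) [:: p, a, b, c & P].
    exact/permPl/(perm_catCA [:: a; b; c] [:: p] P).
  have sys' : signed_system [:: \prod_(y <- [:: p, a, b, c & P]) y; a; b; c] P.
    split.
    + apply: (exchange_system (x := p)); last exact: perm_anticomm_system sys.
      by have := congr1 odd sizeNP; rewrite oddM /= !negbK => ->.
    + move=> x; rewrite inE => /orP[/eqP->|/sN//].
      by rewrite (signed_system_prod sysNP _ sizeNP) //= exprS sqrrN expr1n mulr1 scaleN1r.
    by move=> x Px; apply: sP; rewrite inE Px orbT.
  have [P' [sizeP' sys0]] := signed_system_flip4 sys'.
  by exists [::], P'; split=> //; rewrite sizeP' -sizeNP /=; lia.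
(* Four or more: flip the first four and recurse on the number of minus signs. *)
have [P' [sizeP' sys']] := signed_system_flip4 sysNP.
apply: (IH N P') => //; first by move: lekN => /=; lia.
by rewrite sizeP' -sizeNP /=; lia.
Qed.

End SignedSystems.

(** * The reflection in the first coordinate of a diagonal space *)

Section CoordinateReflection.
Variables (K : fieldType) (m : nat) (c : 'I_m.+1 -> K).
Hypothesis char2 : (2%:R : K) != 0.
Notation V := (diag_space c).

(** Coordinate 0 is singled out because the only element of sign -1 comes first in [N ++ P]. *)
Definition negate_coord0 (x : 'rV[K]_m.+1) : 'rV[K]_m.+1 :=
  \row_i ((-1) ^+ (i == ord0) * x 0 i).

Lemma negate_coord0_is_linear : linear negate_coord0.
Proof. by move=> k x y; apply/rowP => i; rewrite !mxE mulrDr mulrCA. Qed.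
HB.instance Definition _ := GRing.isLinear.Build K 'rV[K]_m.+1 'rV[K]_m.+1 *:%R
  negate_coord0 negate_coord0_is_linear.

Definition coord0_reflection : 'End(V) := linfun (negate_coord0 : V -> V).

Lemma coord0_reflectionE (x : V) : coord0_reflection x = negate_coord0 x.
Proof. by rewrite lfunE. Qed.

(** The diagonal form only sees squares of coordinates. The fixed space is the kernel of the first
    coordinate, as 2 is invertible. *)
Lemma coord0_reflectionP : reflection coord0_reflection.
Proof.
have sgn2 (i : 'I_m.+1) : (-1) ^+ (i == ord0) * (-1) ^+ (i == ord0) = 1 :> K.
  by rewrite -expr2 sqrr_sign.
split.
  split=> [x y|].
    rewrite !bform_diag_space // !coord0_reflectionE; apply: eq_bigr => i _.
    by rewrite !mxE -!mulrA [in LHS](mulrCA (x 0 i)) [in LHS](mulrA _ _ (x 0 i * _)) sgn2 mul1r.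

  apply/lfunP => x; rewrite comp_lfunE id_lfunE !coord0_reflectionE.
  by apply/rowP => i; rewrite !mxE mulrA sgn2 mul1r.
pose p (x : V) : K^o := (x : 'rV_m.+1) 0 ord0.
have pL : linear p by move=> k x y; rewrite /p !mxE.
pose pM := GRing.isLinear.Build K V K^o *:%R p pL.
pose f : {linear V -> K^o} := HB.pack p pM.
have fixE : fixedSpace coord0_reflection = lker (linfun f).
  apply/vspaceP => x; rewrite memv_ker lfunE /=; apply/fixedSpaceP/eqP.
    rewrite coord0_reflectionE => /rowP/(_ ord0).
    rewrite mxE eqxx expr1 mulN1r => /eqP.
    rewrite -subr_eq0 -opprD oppr_eq0 -mulr2n -mulr_natl mulf_eq0 (negPf char2).
    by move/eqP.
  move=> x0; rewrite coord0_reflectionE; apply/rowP => i; rewrite mxE.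
  by have [->|_] := eqVneq i ord0; rewrite ?mul1r // [x 0 _]x0 mulr0.
(* The coordinate form is onto [K], so its kernel is a hyperplane by the rank formula. *)
have imf : limg (linfun f) = {:K^o}%VS.
  apply/eqP; rewrite eqEsubv subvf; apply/subvP => k _.
  have -> : k = linfun f (k *: (delta_mx 0 ord0 : V)).
    by rewrite lfunE /= /p !mxE !eqxx mulr1.
  exact/memv_img/memvf.
have := limg_ker_dim (linfun f) {:V}.
by rewrite capfv -fixE imf [X in (_ + X)%N]dimvf addn1.
Qed.

End CoordinateReflection.

(** * From signed systems to Clifford algebras with involution *)

Section SystemIsomorphisms.
Variables (K : fieldType) (A : falgType K) (sigma : A -> A) (n : nat).
Hypothesis char2 : (2%:R : K) != 0.
Hypothesis inv_sigma : first_kind_involution sigma.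
Hypothesis dimA : \dim {:A} = (2 ^ (2 * n))%N.
Hypotheses (n_gt0 : (0 < n)%N) (n_even : ~~ odd n).

Lemma involution_comb s (x : 'rV[K]_(size s)) :
  sigma (system_comb x) = \sum_i x 0 i *: sigma s`_i.
Proof.
have [sL _ _] := inv_sigma.
pose mS := GRing.isLinear.Build K A A *:%R sigma sL.
pose S : {linear A -> A} := HB.pack sigma mS.
rewrite -[sigma _]/(S _) linear_sum.
by apply: eq_bigr => i _; rewrite linearZ.
Qed.

Lemma system_squares (s : seq A) : anticomm_system s ->
  exists c : 'I_(size s) -> K, forall i : 'I_(size s), s`_i * s`_i = (c i)%:A.
Proof.
move=> [_ sq_s].
have /fin_all_exists : forall i : 'I_(size s), exists d, s`_i * s`_i = d%:A.
  by move=> i; have [d _ dE] := sq_s _ (mem_nth 0 (ltn_ord i)); exists d.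
by [].
Qed.

Lemma isom_clifford_scalar s (e : K) : anticomm_system s -> size s = (2 * n)%N ->
    {in s, forall x, sigma x = e *: x} ->
  exists V : quadSpace K, \dim {:V} = (2 * n)%N /\
    isom_clifford sigma (e *: \1%VF : 'End(V)).
Proof.
move=> sys_s size_s sE; have [c cE] := system_squares sys_s.
exists (diag_space c); rewrite dim_diag_space; split=> //.
apply: isom_clifford_system => //; rewrite ?size_s ?oddM //.
move=> x; rewrite involution_comb scale_lfunE id_lfunE linearZ /= scaler_sumr.
by apply: eq_bigr => i _; rewrite sE ?mem_nth // !scalerA mulrC.
Qed.

(** For the second space every element is multiplied by the product of the whole list, whose size is
    a multiple of 4; this makes all signs -1 and changes the squares, hence the form. *)
Lemma isom_clifford_plus s : anticomm_system s -> size s = (2 * n)%N ->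
    {in s, forall x, sigma x = x} ->
  exists V V' : quadSpace K,
    [/\ \dim {:V} = (2 * n)%N, \dim {:V'} = (2 * n)%N,
        isom_clifford sigma (\1%VF : 'End(V))
      & isom_clifford sigma (- \1%VF : 'End(V'))].
Proof.
move=> sys_s size_s sE.
have sE1 : {in s, forall x, sigma x = 1 *: x} by move=> x /sE ->; rewrite scale1r.
have [V [dimV isoV]] := isom_clifford_scalar sys_s size_s sE1.
have size_s4 : size s = (4 * n./2)%N by rewrite size_s; lia.
have even_s : ~~ odd (size s) by rewrite size_s oddM.
have sys_s' : anticomm_system [seq x * \prod_(y <- s) y | x <- s].
  by have := @block_flip_system _ _ char2 s [::] even_s; rewrite !cats0; apply.
have sE' := block_flip_sign char2 inv_sigma size_s4 sys_s (expr1n _ _) sE1.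
have [|V' [dimV' isoV']] := isom_clifford_scalar sys_s' _ sE'.
  by rewrite size_map.
exists V, V'; split=> //; first by rewrite scale1r in isoV.
by rewrite scaleN1r in isoV'.
Qed.

Lemma isom_clifford_reflection a P :
    signed_system sigma [:: a] P -> size (a :: P) = (2 * n)%N ->
  exists (V : quadSpace K) (tau : 'End(V)),
    [/\ \dim {:V} = (2 * n)%N, reflection tau & isom_clifford sigma tau].
Proof.
move=> [sys sN sP] size_s; have [c cE] := system_squares sys.
exists (diag_space c), (coord0_reflection c); rewrite dim_diag_space.
split=> //; first exact: coord0_reflectionP.
apply: isom_clifford_system => //; try by rewrite [size _]size_s ?oddM.
move=> x; rewrite involution_comb coord0_reflectionE; apply: eq_bigr => i _.
(* Index 0 is [a]; a lifted index points into [P]. *)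
rewrite mxE; case: (unliftP ord0 i) => [j|] ->.
  rewrite eq_sym (negPf (neq_lift _ _)) mul1r sP // lift0 /=.
  by rewrite mem_nth // -ltnS.
by rewrite eqxx expr1 sN ?mem_head // scalerN mulN1r scaleNr.
Qed.

(** After the reduction to at most one minus sign, two of the four parts are constructed; in the
    other two the trace would give [2 ^ n = - 2 ^ n]. *)
Lemma system_isomorphisms N P :
    signed_system sigma N P -> (size N + size P)%N = (2 * n)%N ->
  [/\ n = 0 %[mod 4] -> orthogonal_involution sigma ->
      exists V V' : quadSpace K,
        [/\ \dim {:V} = (2 * n)%N, \dim {:V'} = (2 * n)%N,
            isom_clifford sigma (\1%VF : 'End(V))
          & isom_clifford sigma (- \1%VF : 'End(V'))],
      n = 0 %[mod 4] -> symplectic_involution sigma ->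
      exists (V : quadSpace K) (tau : 'End(V)),
        [/\ \dim {:V} = (2 * n)%N, reflection tau & isom_clifford sigma tau],
      n = 2 %[mod 4] -> symplectic_involution sigma ->
      exists V V' : quadSpace K,
        [/\ \dim {:V} = (2 * n)%N, \dim {:V'} = (2 * n)%N,
            isom_clifford sigma (\1%VF : 'End(V))
          & isom_clifford sigma (- \1%VF : 'End(V'))]
    & n = 2 %[mod 4] -> orthogonal_involution sigma ->
      exists (V : quadSpace K) (tau : 'End(V)),
        [/\ \dim {:V} = (2 * n)%N, reflection tau & isom_clifford sigma tau]].
Proof.
move=> sysNP0 size0; pose h := n./2; have nE : n = (2 * h)%N by rewrite /h; lia.
have h_gt0 : (0 < h)%N by lia.
have [|N' [P' []]] := signed_system_reduce char2 inv_sigma h_gt0 sysNP0.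
  by rewrite size0 nE mulnA.
move: N' P' => {N P sysNP0 size0} N P sysNP sizeNP leN.
have [sL _ _] := inv_sigma.
pose mS := GRing.isLinear.Build K A A *:%R sigma sL.
pose S : {linear A -> A} := HB.pack sigma mS.
have [sys sN sP] := sysNP.
have size_s : size (N ++ P) = (2 * n)%N by rewrite size_cat sizeNP nE mulnA.
have trE : coord_trace sigma = (sign_sums (nseq (size N) (-1) ++ nseq (size P) 1)).1.
  rewrite -(map_minus_sign char2 sysNP).
  apply: (@coord_trace_system _ _ S) => //; rewrite ?size_s ?oddM //.
  exact: signed_system_sign.
have oTr : orthogonal_involution sigma -> coord_trace sigma = 2 ^+ n.
  exact: (@orthogonal_coord_trace _ _ S _ dimA).
have sTr : symplectic_involution sigma -> coord_trace sigma = - 2 ^+ n.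
  exact: (@symplectic_coord_trace _ _ S _ dimA).
have pow2 : 2 ^+ n != - 2 ^+ n :> K.
  have: (2%:R : K) ^+ n != 0 by rewrite expf_neq0.
  move: (_ ^+ n) => z z0; rewrite -addr_eq0 -mulr2n -mulr_natl.
  by rewrite mulf_neq0.
have m4E : (- 4%:R) ^+ h = (-1) ^+ h * 2 ^+ n :> K.
  by rewrite nE exprM -exprMn; congr (_ ^+ _); ring.
(* With [n = 2h], the trace is [(-1)^h 2^n] without a minus sign and its opposite with one; [h] is
   even exactly when 4 divides [n]. *)
case: N leN => [|a [|//]] _ in sysNP sizeNP sys sN size_s trE.
  have {}trE : coord_trace sigma = (-1) ^+ h * 2 ^+ n.
    by rewrite trE -m4E (_ : size P = (4 * h)%N) // sign_sums_nseq1.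
  split.
  - by move=> _ _; exact: isom_clifford_plus sys size_s sP.
  - move=> n4 /sTr; rewrite trE -signr_odd (_ : odd h = false); last by lia.
    by move/eqP; rewrite mul1r (negPf pow2).
  - by move=> _ _; exact: isom_clifford_plus sys size_s sP.
  move=> n4 /oTr; rewrite trE -signr_odd (_ : odd h = true); last by lia.
  by move/eqP; rewrite expr1 mulN1r eq_sym (negPf pow2).
have {}trE : coord_trace sigma = - ((-1) ^+ h * 2 ^+ n).
  (* One minus sign leaves [4h - 1 = 4(h - 1) + 3] plus signs, whence the shift of [h]. *)
  rewrite trE -m4E; have <- : h.-1.+1 = h by lia.
  rewrite -sign_sums_consN1.
  by congr (sign_sums (_ :: nseq _ _)).1; move: sizeNP => /=; lia.
split.
- move=> n4 /oTr; rewrite trE -signr_odd (_ : odd h = false); last by lia.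
  by move/eqP; rewrite mul1r eq_sym (negPf pow2).
- by move=> _ _; exact: isom_clifford_reflection sysNP size_s.
- move=> n4 /sTr; rewrite trE -signr_odd (_ : odd h = true); last by lia.
  by move/eqP; rewrite expr1 mulN1r opprK (negPf pow2).
by move=> _ _; exact: isom_clifford_reflection sysNP size_s.
Qed.

End SystemIsomorphisms.

(** * Involutions of quaternion algebras *)

Section QuaternionAlgebra.
Variables (K : fieldType) (Q : falgType K) (a b : K) (u v : Q).
Hypotheses (uu : u * u = a%:A) (vv : v * v = b%:A) (vu : v * u = - (u * v)).
Hypothesis basisQ : basis_of {:Q} [:: 1; u; v; u * v].

Definition quat (c0 c1 c2 c3 : K) : Q :=
  c0 *: 1 + c1 *: u + c2 *: v + c3 *: (u * v).

Let B := [tuple 1; u; v; u * v].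
Let freeB : free B. Proof. exact: basis_free basisQ. Qed.

Lemma quat_surj x : exists c0 c1 c2 c3, x = quat c0 c1 c2 c3.
Proof.
have : x \in <<B>>%VS by rewrite (span_basis (X := B) basisQ) memvf.
move/coord_span; rewrite !big_ord_recl big_ord0 addr0 !addrA => ->.
by do 4! eexists.
Qed.

Lemma coord_quat (i : 'I_4) c0 c1 c2 c3 :
  coord B i (quat c0 c1 c2 c3) = [:: c0; c1; c2; c3]`_i.
Proof.
pose k (j : 'I_4) := [:: c0; c1; c2; c3]`_j.
have -> : quat c0 c1 c2 c3 = \sum_j k j *: B`_j.
  by rewrite !big_ord_recl big_ord0 addr0 !addrA.
by rewrite coord_sum_free.
Qed.

Lemma quat_inj c0 c1 c2 c3 d0 d1 d2 d3 :
  quat c0 c1 c2 c3 = quat d0 d1 d2 d3 -> [/\ c0 = d0, c1 = d1, c2 = d2 & c3 = d3].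
Proof.
move=> eq_cd; have e i := congr1 (coord B i) eq_cd.
split; [have := e 0 | have := e 1 | have := e 2%:R | have := e 3%:R];
  by rewrite !coord_quat.
Qed.

Lemma quatD c0 c1 c2 c3 d0 d1 d2 d3 :
  quat c0 c1 c2 c3 + quat d0 d1 d2 d3 =
  quat (c0 + d0) (c1 + d1) (c2 + d2) (c3 + d3).
Proof. by rewrite /quat !scalerDl addrACA (addrACA (_ *: 1 + _)) (addrACA (_ *: 1)). Qed.

Lemma quatZ k c0 c1 c2 c3 :
  k *: quat c0 c1 c2 c3 = quat (k * c0) (k * c1) (k * c2) (k * c3).
Proof. by rewrite /quat !scalerDr !scalerA. Qed.

Lemma quatM c0 c1 c2 c3 d0 d1 d2 d3 :
  quat c0 c1 c2 c3 * quat d0 d1 d2 d3 =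
  quat (c0 * d0 + a * c1 * d1 + b * c2 * d2 - a * b * c3 * d3)
       (c0 * d1 + c1 * d0 - b * c2 * d3 + b * c3 * d2)
       (c0 * d2 + c2 * d0 + a * c1 * d3 - a * c3 * d1)
       (c0 * d3 + c3 * d0 + c1 * d2 - c2 * d1).
Proof.
have uM e0 e1 e2 e3 : u * quat e0 e1 e2 e3 = quat (a * e1) e0 (a * e3) e2.
  rewrite /quat !mulrDr -!scalerAr mulr1 mulrA uu mulr_algl !scalerA.
  by rewrite addrAC [e0 *: u + _]addrC [e1 * a]mulrC [e3 * a]mulrC.
have vM : v * quat d0 d1 d2 d3 = quat (b * d2) (- b * d3) d0 (- d1).
  rewrite /quat !mulrDr -!scalerAr mulr1 mulrA vu vv mulNr -mulrA vv.
  rewrite mulr_algr !scalerN !scalerA -addrA addrC addrA.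
  by rewrite [d2 * b]mulrC [d3 * b]mulrC mulNr !scaleNr.
have quatE : quat c0 c1 c2 c3 * quat d0 d1 d2 d3 =
    c0 *: quat d0 d1 d2 d3 + c1 *: (u * quat d0 d1 d2 d3) +
    c2 *: (v * quat d0 d1 d2 d3) + c3 *: (u * (v * quat d0 d1 d2 d3)).
  by rewrite {1}/quat !mulrDl -!scalerAl mul1r mulrA.
by rewrite quatE vM !uM !quatZ !quatD; congr quat; ring.
Qed.

Definition pure_quat x : Prop := exists c1 c2 c3, x = quat 0 c1 c2 c3.

Lemma pure_quatD x y : pure_quat x -> pure_quat y -> pure_quat (x + y).
Proof.
move=> [c1 [c2 [c3 ->]]] [d1 [d2 [d3 ->]]]; rewrite quatD addr0.
by do 3! eexists.
Qed.

Lemma pure_quatZ k x : pure_quat x -> pure_quat (k *: x).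
Proof. by move=> [c1 [c2 [c3 ->]]]; rewrite quatZ mulr0; do 3! eexists. Qed.

(** The scalar coordinate of a product is symmetric in the two factors. *)
Lemma pure_quat_commutator x y : pure_quat (x * y - y * x).
Proof.
have [c0 [c1 [c2 [c3 ->]]]] := quat_surj x.
have [d0 [d1 [d2 [d3 ->]]]] := quat_surj y.
rewrite -scaleN1r !quatM quatZ quatD; do 3! eexists.
by congr quat; ring.
Qed.

Lemma pure_quat_sqr x : pure_quat x -> exists c, x * x = c%:A.
Proof.
move=> [c1 [c2 [c3 ->]]]; rewrite quatM.
exists (a * c1 * c1 + b * c2 * c2 - a * b * c3 * c3).
have -> k : k%:A = quat k 0 0 0 by rewrite /quat !scale0r !addr0.
by congr quat; ring.
Qed.

Lemma pure_quat_unit_square x : pure_quat x -> x * x != 0 -> unit_square x.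
Proof.
move=> /pure_quat_sqr[c cE] xx0; exists c => //.
by apply: contraNneq xx0 => c0; rewrite cE c0 scale0r.
Qed.

Section Involution.
Variable sigma : Q -> Q.
Hypothesis inv_sigma : first_kind_involution sigma.
Hypothesis char2 : (2%:R : K) != 0.
Hypotheses (a0 : a != 0) (b0 : b != 0).

Let char4 : (4%:R : K) != 0.
Proof. by rewrite -[4%N]/(2 * 2)%N natrM mulf_neq0. Qed.

Let scalarE k : k%:A = quat k 0 0 0.
Proof. by rewrite /quat !scale0r !addr0. Qed.

Let sigmaZ k x : sigma (k *: x) = k *: sigma x.
Proof.
have [sL _ _] := inv_sigma.
have s0 : sigma 0 = 0 by have := sL (-1) 0 0; rewrite scaler0 addr0 scaleN1r addNr.
by have := sL k x 0; rewrite s0 !addr0.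
Qed.

Let sigma1 : sigma 1 = 1.
Proof.
have [_ sM sK] := inv_sigma.
by rewrite -[LHS]mulr1 -{2}[1]sK -sM mulr1 sK.
Qed.

(** [sigma x] has a scalar square, so twice its scalar part [d0] times each other coordinate is 0.
    If [d0] is nonzero, [sigma x] is a scalar, hence so is [x], which is pure; then [d0 = 0] after
    all. *)
Lemma pure_quat_involution x : pure_quat x -> pure_quat (sigma x).
Proof.
move=> px; have [c cE] := pure_quat_sqr px; have [sL sM sK] := inv_sigma.
have [d0 [d1 [d2 [d3 sE]]]] := quat_surj (sigma x).
have := sM x x; rewrite cE sigmaZ sigma1 scalarE sE quatM => /quat_inj[_].
have half d : 0 = d0 * d + d * d0 -> d0 = 0 \/ d = 0.
  move/esym/eqP; rewrite [d * _]mulrC -mulr2n -mulr_natl !mulf_eq0 (negPf char2) /=.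
  by case/orP => /eqP; auto.
have -> : d0 * d1 + d1 * d0 - b * d2 * d3 + b * d3 * d2 = d0 * d1 + d1 * d0 by ring.
have -> : d0 * d2 + d2 * d0 + a * d1 * d3 - a * d3 * d1 = d0 * d2 + d2 * d0 by ring.
have -> : d0 * d3 + d3 * d0 + d1 * d2 - d2 * d1 = d0 * d3 + d3 * d0 by ring.
have pure0 : d0 = 0 -> pure_quat (quat d0 d1 d2 d3) by move=> ->; do 3! eexists.
move=> /half[/pure0//|d10] /half[/pure0//|d20] /half[/pure0//|d30].
rewrite d10 d20 d30 in sE pure0 *; apply: pure0.
have [c1 [c2 [c3 xE]]] := px.
by have := sK x; rewrite sE -scalarE sigmaZ sigma1 scalarE xE => /quat_inj[].
Qed.

(* (z + sigma z)^2 + (z - sigma z)^2 = 4 z^2, since sigma z and z have the same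
   square. *)
Lemma pure_quat_eigen z : pure_quat z -> z * z != 0 ->
  exists e : bool, let w := z + (-1) ^+ e *: sigma z in
    unit_square w /\ sigma w = (-1) ^+ e *: w.
Proof.
move=> pz zz0; have [sL sM sK] := inv_sigma.
pose w (e : bool) := z + (-1) ^+ e *: sigma z.
have pw e : pure_quat (w e).
  exact/pure_quatD/pure_quatZ/pure_quat_involution.
have sw e : sigma (w e) = (-1) ^+ e *: w e.
  by rewrite /w addrC sL sK scalerDr signrZK addrC.
have [e we0] : exists e, w e * w e != 0.
  apply/existsP; apply: contraR zz0; rewrite negb_exists => /forallP w0.
  have szz : sigma z * sigma z = z * z.
    have [c cE] := pure_quat_sqr pz.
    by rewrite -sM cE sigmaZ sigma1.
  have: w false * w false + w true * w true = 4%:R *: (z * z).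
    rewrite /w expr0 expr1 scale1r scaleN1r !mulrDl !mulrDr !mulrN !mulNr opprK szz.
    rewrite (addrACA (z * z + _)) (addrACA (z * z)) subrr addr0.
    by rewrite (addrACA (sigma z * z)) subrr add0r scaler_nat -!mulr2n -mulrnA.
  have /negbNE/eqP-> := w0 false; have /negbNE/eqP-> := w0 true.
  by rewrite addr0 => /esym/eqP; rewrite scaler_eq0 (negPf char4) /=.
by exists e; split; [exact: pure_quat_unit_square (pw e) we0 | exact: sw].
Qed.

(** If the commutators with [u], [v] and [uv] all had square 0, three linear relations between the
    squares of the coordinates of [x] would follow, and they force [x = 0]. *)
Lemma anticommuting_pure_quat x : pure_quat x -> x != 0 ->
  exists t, (x * t - t * x) * (x * t - t * x) != 0.
Proof.
move=> [c1 [c2 [c3 xE]]] x0.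
pose T := [:: quat 0 1 0 0; quat 0 0 1 0; quat 0 0 0 1].
case: (boolP (has (fun t => (x * t - t * x) * (x * t - t * x) != 0) T)).
  by move=> /hasP[t _ t0]; exists t.
move=> /hasPn T0; case/eqP: x0.
have eq0 t : t \in T -> (x * t - t * x) * (x * t - t * x) = quat 0 0 0 0.
  by move=> /T0/negbNE/eqP ->; rewrite -scalarE scale0r.
have := eq0 (quat 0 1 0 0); rewrite !inE eqxx => /(_ isT).
have := eq0 (quat 0 0 1 0); rewrite !inE eqxx orbT => /(_ isT).
have := eq0 (quat 0 0 0 1); rewrite !inE eqxx !orbT => /(_ isT).
rewrite xE -!scaleN1r !quatM !quatZ !quatD !quatM.
move=> /quat_inj[e3 _ _ _] /quat_inj[e2 _ _ _] /quat_inj[e1 _ _ _].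
have nz : 4%:R * a * b != 0 by rewrite !mulf_neq0.
have {}e1 : a * c3 ^+ 2 - c2 ^+ 2 = 0.
  apply: (mulfI nz); rewrite mulr0 -[RHS]e1; ring.
have {}e2 : b * c3 ^+ 2 - c1 ^+ 2 = 0.
  apply: (mulfI nz); rewrite mulr0 -[RHS]e2; ring.
have {}e3 : b * c2 ^+ 2 + a * c1 ^+ 2 = 0.
  apply: (mulfI nz); rewrite mulr0 -[RHS]e3; ring.
have c30 : c3 = 0.
  have /eqP : (2%:R * a * b) * c3 ^+ 2 = 0.
    transitivity (b * (a * c3 ^+ 2 - c2 ^+ 2) + a * (b * c3 ^+ 2 - c1 ^+ 2) +
                  (b * c2 ^+ 2 + a * c1 ^+ 2)); first by ring.
    by rewrite e1 e2 e3 !mulr0 !addr0.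
  have nz2 : 2%:R * a * b != 0 by rewrite !mulf_neq0.
  by rewrite mulf_eq0 (negPf nz2) expf_eq0 => /eqP.
have c10 : c1 = 0.
  by move: e2; rewrite c30 expr0n mulr0 sub0r => /eqP; rewrite oppr_eq0 expf_eq0 => /eqP.
have c20 : c2 = 0.
  by move: e1; rewrite c30 expr0n mulr0 sub0r => /eqP; rewrite oppr_eq0 expf_eq0 => /eqP.
by rewrite c10 c20 c30 -scalarE scale0r.
Qed.

(** [x] is an eigenvector made from [u], and [y] one made from a commutator [z] of [x], which
    anticommutes with [x]. Passing from [z] to its eigenvector keeps this, because [sigma x] is [x]
    up to sign. *)
Lemma quaternion_anticommuting_pair : exists (x y : Q) (e d : bool),
  [/\ anticomm x y, unit_square x, unit_square y,
      sigma x = (-1) ^+ e *: x & sigma y = (-1) ^+ d *: y].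
Proof.
have [sL sM sK] := inv_sigma.
have pu : pure_quat u by exists 1, 0, 0; rewrite /quat !scale0r scale1r add0r !addr0.
have [|e [sq_x sx]] := pure_quat_eigen pu.
  by rewrite uu scaler_eq0 (negPf a0) oner_eq0.
set x := u + _ in sq_x sx.
have px : pure_quat x by exact/pure_quatD/pure_quatZ/pure_quat_involution.
have [c c0 xx] := sq_x.
have x0 : x != 0.
  apply: contraNneq c0 => x0; move/eqP: xx.
  by rewrite x0 mul0r eq_sym scaler_eq0 oner_eq0 orbF.
have [t tt0] := anticommuting_pure_quat px x0.
set z := x * t - t * x in tt0.
(* Both sides agree because [x * x] is a scalar, hence central. *)
have xz : x * z = - (z * x).
  by rewrite /z mulrBr mulrBl opprB !mulrA xx -[t * x * x]mulrA xx mulr_algl mulr_algr.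
have [d [sq_y sy]] := pure_quat_eigen (pure_quat_commutator x t) tt0.
exists x, (z + (-1) ^+ d *: sigma z), e, d; split=> //.
(* Apply [sigma] to [xz]; the sign of [x] occurs on both sides and cancels. *)
have xsz : x * sigma z = - (sigma z * x).
  have /(congr1 sigma) := xz; rewrite -scaleN1r sigmaZ !sM sx -scalerAl -scalerAr.
  rewrite scalerA mulrC -scalerA => /(inv_inj (signrZK _)).
  by move=> ->; rewrite scaleN1r opprK.
by rewrite /anticomm mulrDr (mulrDl z) xz -scalerAl -scalerAr xsz opprD scalerN.
Qed.

End Involution.
End QuaternionAlgebra.

(** * Tensor products *)

Section TensorProductFacts.
Variables (K : fieldType) (I : finType) (Q : I -> falgType K).

Lemma pure_tensorZ (k : I -> K) (x : forall i, Q i) :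
  pure_tensor (fun i => k i *: x i) = (\prod_i k i) *: pure_tensor x.
Proof.
apply: tensorP => f; rewrite Defs.coefZ !coef_pure -big_split.
by apply: eq_bigr => i _; rewrite linearZ.
Qed.

Lemma unit_square_pure (x : forall i, Q i) :
  (forall i, unit_square (x i)) -> unit_square (pure_tensor x).
Proof.
move=> sq_x.
have /fin_all_exists[c cP] : forall i, exists c : K, c != 0 /\ x i * x i = c%:A.
  by move=> i; have [c c0 cE] := sq_x i; exists c.
exists (\prod_i c i).
  by apply/prodf_neq0 => i _; case: (cP i).
rewrite pure_tensorM -pure_tensorZ; apply: pure_ext => i.
by case: (cP i).
Qed.

Lemma tensor_map_involution (sigma : forall i, Q i -> Q i) :
  (forall i, first_kind_involution (sigma i)) ->
  first_kind_involution (tensor_map sigma).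
Proof.
move=> inv_sigma; have sL i : linear (sigma i) by case: (inv_sigma i).
have TL := @tensor_map_is_linear K I Q sigma.
have T0 : tensor_map sigma 0 = 0.
  by have := TL (-1) 0 0; rewrite scaler0 addr0 scaleN1r addNr.
have TZ k a : tensor_map sigma (k *: a) = k *: tensor_map sigma a.
  by have := TL k a 0; rewrite T0 !addr0.
split=> //.
  move=> a b; elim/tensor_ind: a => [k a a' IH IH'|x|].
  - by rewrite mulrDl -scalerAl !TL IH IH' mulrDr -scalerAr.
  - elim/tensor_ind: b => [k b b' IH IH'|y|].
    + by rewrite mulrDr -scalerAr !TL IH IH' mulrDl -scalerAl.
    + rewrite pure_tensorM !tensor_map_pure // pure_tensorM; apply: pure_ext => i.
      by case: (inv_sigma i).
    by rewrite mulr0 T0 mul0r.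
  by rewrite mul0r T0 mulr0.
elim/tensor_ind => [k a a' IH IH'|x|]; rewrite ?T0 //.
  by rewrite !TL IH IH'.
rewrite !tensor_map_pure //; apply: pure_ext => i.
by case: (inv_sigma i).
Qed.

Lemma dim_tensor_prod : \dim {:tensor_prod Q} = (\prod_i \dim {:Q i})%N.
Proof.
rewrite dimvf -[dim _]/(#|tensor_index Q| * 1)%N muln1 card_fprod.
by apply: eq_bigr => i _; rewrite card_ord.
Qed.

End TensorProductFacts.


(** * The Jordan-Wigner system in a tensor product *)

Section JordanWigner.
Variables (K : fieldType) (n : nat) (Q : 'I_n -> falgType K).
Variables (x y : forall i, Q i).
Hypotheses (xy : forall i, anticomm (x i) (y i)).
Hypotheses (sq_x : forall i, unit_square (x i)) (sq_y : forall i, unit_square (y i)).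

(** The pure tensor with [x_j y_j] before position [p.1], then [x] or [y] according to [p.2], then 1
    at all later positions. *)
Definition jw_factor (p : 'I_n * bool) (j : 'I_n) : Q j :=
  if (j < p.1)%N then x j * y j else
  if j == p.1 then (if p.2 then x j else y j) else 1.

Definition jw_gen (p : 'I_n * bool) : tensor_prod Q := pure_tensor (jw_factor p).

Lemma unit_square_mul i : unit_square (x i * y i).
Proof.
have [c c0 cE] := sq_x i; have [d d0 dE] := sq_y i.
exists (- (c * d)); first by rewrite oppr_eq0 mulf_neq0.
have /eqP xyi := xy i.
rewrite {1}xyi mulNr mulrA -(mulrA (y i)) cE -scalerAr mulr1 -scalerAl dE.
by rewrite scalerA scaleNr.
Qed.

Lemma jw_gen_unit_square p : unit_square (jw_gen p).
Proof.
apply: unit_square_pure => i; rewrite /jw_factor.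
case: ifP => _; first exact: unit_square_mul.
case: ifP => _; first by case: p.2.
by exists 1; rewrite ?oner_eq0 // mulr1 scale1r.
Qed.

(** The two tensors anticommute in exactly one factor, the smaller of the two positions: [x] or [y]
    meets there the product [xy] or its partner. All other factors commute. *)
Lemma jw_gen_anticomm p p' : p != p' -> anticomm (jw_gen p) (jw_gen p').
Proof.
wlog le_pp' : p p' / (p.1 <= p'.1)%N => [IH|] neq_pp'.
  have [|/ltnW] := leqP p.1 p'.1; first by move/IH; apply.
  by move/IH; rewrite anticomm_sym eq_sym; apply.
rewrite /anticomm !pure_tensorM.
(* The global sign is moved into the factor at [p.1]. *)
have -> : - pure_tensor (fun i => jw_factor p' i * jw_factor p i) =
    pure_tensor (fun i => (-1) ^+ (i == p.1) *: (jw_factor p' i * jw_factor p i)).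
  rewrite pure_tensorZ (bigD1 p.1) //= eqxx big1 => [|i /negPf->//].
  by rewrite expr1 mulr1 scaleN1r.
apply/eqP/pure_ext => i; have /eqP xyi := xy i.
rewrite /jw_factor; case: (ltngtP i p.1) => [lt_ip|lt_pi|/val_inj eq_ip].
- by rewrite (leq_trans lt_ip) // (ltn_eqF lt_ip : (i == p.1) = false) scale1r.
- by rewrite (gtn_eqF lt_pi : (i == p.1) = false) mul1r mulr1 scale1r.
rewrite eq_ip eqxx expr1 scaleN1r -eq_ip.
move: le_pp'; rewrite leq_eqVlt -eq_ip => /orP[/eqP/val_inj eq_ip'|lt_ip'].
  rewrite -eq_ip' ltnn eqxx.
  have : p.2 != p'.2.
    apply: contraNneq neq_pp'; rewrite [p]surjective_pairing [p']surjective_pairing /= => ->.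
    by rewrite -eq_ip -eq_ip'.
  by case: p.2; case: p'.2 => // _; rewrite xyi ?opprK.
rewrite lt_ip'; have [c _ cE] := sq_x i; have [d _ dE] := sq_y i.
case: p.2.
  by rewrite -mulrA -[y i * x i]opprK -xyi mulrN opprK.
by rewrite mulrA -[y i * x i]opprK -xyi mulNr.
Qed.

Definition jw_system : seq (tensor_prod Q) :=
  [seq jw_gen p | p <- enum {: 'I_n * bool}].

Lemma jw_system_anticomm : anticomm_system jw_system.
Proof.
split; last by move=> _ /mapP[p _ ->]; apply: jw_gen_unit_square.
rewrite pairwise_map; have := enum_uniq {: 'I_n * bool}; rewrite uniq_pairwise.
by apply: sub_pairwise => p p'; apply: jw_gen_anticomm.
Qed.

Lemma size_jw_system : size jw_system = (2 * n)%N.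
Proof. by rewrite size_map -cardE card_prod card_ord card_bool mulnC. Qed.

Lemma jw_system_involution (sigma : forall i, Q i -> Q i) (e d : 'I_n -> bool) :
  (forall i, first_kind_involution (sigma i)) ->
  (forall i, sigma i (x i) = (-1) ^+ e i *: x i) ->
  (forall i, sigma i (y i) = (-1) ^+ d i *: y i) ->
  {in jw_system, forall z, tensor_map sigma z = z \/ tensor_map sigma z = - z}.
Proof.
move=> inv_sigma sx sy _ /mapP[p _ ->].
rewrite /jw_gen tensor_map_pure => [|i]; last by case: (inv_sigma i).
have /fin_all_exists[f fE] : forall i, exists b : bool,
    sigma i (jw_factor p i) = (-1) ^+ b *: jw_factor p i.
  move=> i; have [_ sM sK] := inv_sigma i; rewrite /jw_factor.
  case: ifP => _.
    (* The negation accounts for [y x = - x y], as [sigma] reverses the product [x y]. *)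
    exists (~~ (e i (+) d i)); have /eqP xyi := xy i.
    rewrite sM sx sy -scalerAl -scalerAr scalerA -[y i * x i]opprK -xyi scalerN.
    by rewrite -signr_addb signrN addbC scaleNr.
  case: ifP => _; first by case: p.2; [exists (e i) | exists (d i)].
  by exists false; rewrite scale1r -[LHS]mulr1 -{2}[1]sK -sM mulr1 sK.
rewrite (pure_ext fE) pure_tensorZ.
have [b ->] : exists b : bool, \prod_i (-1) ^+ f i = (-1) ^+ b :> K.
  elim/big_ind: _ => [|_ _ [b ->] [b' ->]|i _]; first by exists false.
    by exists (b (+) b'); rewrite signr_addb.
  by exists (f i).
by case: b; [right; rewrite scaleN1r | left; rewrite scale1r].
Qed.

End JordanWigner.

Theorem proposition6p9 (K : fieldType) (n : nat) (Q : 'I_n -> falgType K)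
    (sigma : forall i : 'I_n, Q i -> Q i)
    (charK : 2%N \notin [pchar K])
    (n_gt0 : (0 < n)%N) (n_even : ~~ odd n)
    (quatQ : forall i : 'I_n, quaternion_algebra (Q i))
    (invQ : forall i : 'I_n, first_kind_involution (sigma i)) :
  [/\ n = 0 %[mod 4] ->
      orthogonal_involution (tensor_map sigma) ->
      exists V V' : quadSpace K,
        [/\ \dim {:V} = (2 * n)%N, \dim {:V'} = (2 * n)%N,
            isom_clifford (tensor_map sigma) (\1%VF : 'End(V))
          & isom_clifford (tensor_map sigma) (- \1%VF : 'End(V'))],
      n = 0 %[mod 4] ->
      symplectic_involution (tensor_map sigma) ->
      exists (V : quadSpace K) (tau : 'End(V)),
        [/\ \dim {:V} = (2 * n)%N, reflection tau
          & isom_clifford (tensor_map sigma) tau],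
      n = 2 %[mod 4] ->
      symplectic_involution (tensor_map sigma) ->
      exists V V' : quadSpace K,
        [/\ \dim {:V} = (2 * n)%N, \dim {:V'} = (2 * n)%N,
            isom_clifford (tensor_map sigma) (\1%VF : 'End(V))
          & isom_clifford (tensor_map sigma) (- \1%VF : 'End(V'))]
    & n = 2 %[mod 4] ->
      orthogonal_involution (tensor_map sigma) ->
      exists (V : quadSpace K) (tau : 'End(V)),
        [/\ \dim {:V} = (2 * n)%N, reflection tau
          & isom_clifford (tensor_map sigma) tau]].
Proof.
have char2 : (2%:R : K) != 0 by apply: contraNneq charK => k0; apply/andP; rewrite k0.
have dimQ i : \dim {:Q i} = 4%N.
  by have [a [b [u [v [_ _ _ _ basisQ]]]]] := quatQ i; rewrite -(size_basis basisQ).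
have pairQ i : exists (x y : Q i) (e d : bool),
    [/\ anticomm x y, unit_square x, unit_square y,
        sigma i x = (-1) ^+ e *: x & sigma i y = (-1) ^+ d *: y].
  have [a [b [u [v [[a0 b0] uu vv vu basisQ]]]]] := quatQ i.
  exact: (quaternion_anticommuting_pair uu vv vu basisQ (invQ i) char2 a0 b0).
(* Choose an anticommuting pair of eigenvectors in every quaternion factor at once. *)
have [x /fin_all_exists[y /fin_all_exists[e /fin_all_exists[d xyP]]]] :=
  fin_all_exists pairQ.
have xy i : anticomm (x i) (y i) by case: (xyP i).
have sq_x i : unit_square (x i) by case: (xyP i).
have sq_y i : unit_square (y i) by case: (xyP i).
have sx i : sigma i (x i) = (-1) ^+ e i *: x i by case: (xyP i).
have sy i : sigma i (y i) = (-1) ^+ d i *: y i by case: (xyP i).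
have dimA : \dim {:tensor_prod Q} = (2 ^ (2 * n))%N.
  rewrite dim_tensor_prod (eq_bigr _ (fun i _ => dimQ i)).
  by rewrite prod_nat_const card_ord expnM.
have inv_A := tensor_map_involution invQ.
pose s := jw_system x y; pose minus z := tensor_map sigma z == - z.
have sys : anticomm_system s by exact: jw_system_anticomm.
(* The Jordan-Wigner list is split according to the sign of [tensor_map sigma] on its elements. *)
apply: (@system_isomorphisms _ _ _ _ char2 inv_A dimA n_gt0 n_even
  (filter minus s) (filter (predC minus) s)).
  split.
  - by apply: perm_anticomm_system sys => //; rewrite perm_sym perm_filterC.
  - by move=> z; rewrite mem_filter => /andP[/eqP].
  move=> z; rewrite mem_filter => /andP[/= /eqP nz sz].
  by have [|/nz] := jw_system_involution xy invQ sx sy sz.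
by rewrite !size_filter count_predC size_jw_system.
Qed.
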